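(* Let $R:\mathbb{R}^p\to\mathbb{R}\cup\{+\infty\}$ be a proper lower semicontinuous convex function that is bounded from below and mirror-stratifiable with respect to a primal stratification $\mathcal{M}$ of $\mathrm{dom}(\partial R)$ and a dual stratification $\mathcal{M}^*$ of $\mathrm{dom}(\partial R^* )$. Let $\rho$ be a probability measure on $\mathbb{R}^p\times\mathbb{R}$, let $(\mathbf{x},\mathbf{y})\sim\rho$, and assume that $w_0$ is the unique solution of $$\min_{w\in\mathbb{R}^p}\Big\{R(w)\ :\ w\in \operatorname{Argmin}_{w'\in\mathbb{R}^p}\mathbb{E}_\rho\big[(\langle w',\mathbf{x}\rangle-\mathbf{y})^2\big]\Big\}.$$ Suppose that $\mathbb{E}_\rho[\|\mathbf{x}\|^4]<+\infty$ and $\mathbb{E}_\rho[|\mathbf{y}|^4]<+\infty$. Let $(x_i,y_i)_{i\ge 1}$ be i.i.d. pairs sampled from $\rho$, and let $(\lambda_n)_{n\in\mathbb{N}}\subset\,]0,+\infty[$ be such that $$\lambda_n\to 0\quad\text{with}\quad \lambda_n\sqrt{n/(\log\log n)}\to+\infty .$$ Let $\widehat w_{\lambda_n,n}$ be a solution of $$\min_{w\in\mathbb{R}^p}\ \lambda_n R(w)+\frac{1}{2n}\sum_{i=1}^n(\langle x_i,w\rangle-y_i)^2 .$$ Then, for $n$ large enough, the following holds with probability $1$: $$M_{w_0}\ \le\ M_{\widehat w_{\lambda_n,n}}\ \le\ \mathcal{J}_{R^*}(M^*_{\eta_0}),$$ where $\eta_0\in\partial R(w_0)$ is the dual vector defined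 in the context.
   Context: Here $\partial R$ is the convex subdifferential, $\mathrm{dom}(\partial R)=\{w\in\mathbb{R}^p:\partial R(w)\neq\emptyset\}$, $R^*$ is the Legendre-Fenchel conjugate, $\mathrm{ri}$ is the relative interior, $\mathrm{cl}$ the topological closure. Stratification: a stratification of a set $D\subset\mathbb{R}^p$ is a finite partition $\{M_i\}_{i\in I}$ of $D$ such that for any strata $M,M'$, $M\cap\mathrm{cl}(M')\neq\emptyset\Rightarrow M\subset\mathrm{cl}(M')$. It induces the partial ordering $M\le M'\iff M\subset\mathrm{cl}(M')\iff M\cap\mathrm{cl}(M')\neq\emptyset$. For $w\in\mathrm{dom}(\partial R)$, $M_w$ denotes the unique stratum of $\mathcal{M}$ containing $w$; for $\eta\in\mathrm{dom}(\partial R^* )$, $M^*_\eta$ denotes the unique stratum of $\mathcal{M}^*$ containing $\eta$. Correspondence operator: for $S\subset\mathbb{R}^p$, $\mathcal{J}_R(S)=\bigcup_{x\in S}\mathrm{ri}(\partial R(x))$, and similarly $\mathcal{J}_{R^*}(S)=\bigcup_{\eta\in S}\mathrm{ri}(\partial R^*(\eta))$. Mirror-stratifiability: a proper lower semicontinuous convex $R$ is mirror-stratifiable with respect to a (primal) stratification $\mathcal{M}=\{M_i\}_{i\in I}$ of $\mathrm{dom}(\partial R)$ and a (dual) stratification $\mathcal{M}^*=\{M^*_i\}_{i\in I}$ of $\mathrm{dom}(\partial R^* )$ if $\mathcal{J}_R:\mathcal{M}\to\mathcal{M}^*$ is invertible with inverse $\mathcal{J}_{R^*}$ and $\mathcal{J}_R$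 is decreasing for the relation $\le$. Dual vector: let $C=\mathbb{E}_\rho[\mathbf{x}\mathbf{x}^\top]\in\mathbb{R}^{p\times p}$ and $C^\dagger$ its Moore-Penrose pseudo-inverse. Then $\eta_0$ is the (unique) optimal solution of $\min\{\langle C^\dagger\eta,\eta\rangle:\eta\in\partial R(w_0)\cap\mathrm{Im}\,C\}$. *)

(* Defs.v *)
From HB Require Import structures.
From mathcomp Require Import all_boot all_order all_algebra finmap.
From mathcomp Require Import all_classical all_reals all_analysis.

Set Implicit Arguments.
Unset Strict Implicit.
Unset Printing Implicit Defensive.

Import Order.TTheory GRing.Theory Num.Theory.
Import numFieldNormedType.Exports.

Local Open Scope classical_set_scope.
Local Open Scope ring_scope.

Section Euclidean.
Context {K : realType} {p : nat}.
Implicit Types (u v x : 'cV[K]_p).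

Definition dot u v : K := \sum_(i < p) u i 0 * v i 0.

(* The library norm on matrices is the sup norm, hence this one. *)
Definition enorm x : K := Num.sqrt (dot x x).

End Euclidean.

(* The four Penrose equations; over the reals the adjoint is the transpose. *)
Definition is_moore_penrose {K : realType} {m n : nat}
    (A : 'M[K]_(m, n)) (X : 'M[K]_(n, m)) : Prop :=
  [/\ A *m X *m A = A, X *m A *m X = X,
      (A *m X)^T = A *m X & (X *m A)^T = X *m A].

Definition argmin {K : realType} {T : Type} (f : T -> \bar K) (A : set T) :
    set T :=
  [set w | A w /\ forall v, A v -> (f w <= f v)%E].

Section Convex.
Context {K : realType} {p : nat}.
Local Notation V := 'cV[K]_p.
Implicit Types (R : V -> \bar K) (S : set V).

Definition proper_function R : Prop :=
  (forall w, R w != -oo%E) /\ (exists w, R w != +oo%E).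

(* With [0 * +oo = 0] the endpoint cases [t = 0] and [t = 1] are trivial. *)
Definition econvex R : Prop :=
  forall (x y : V) (t : K), 0 <= t <= 1 ->
    (R (t *: x + (1 - t) *: y)%R <= t%:E * R x + (1 - t)%R%:E * R y)%E.

Definition bounded_below R : Prop := exists m : K, forall w, (m%:E <= R w)%E.

(* When [R] is proper this is empty at every [w] with [R w = +oo]. *)
Definition subdiff R (w : V) : set V :=
  [set eta | forall v, (R w + (dot eta (v - w)%R)%:E <= R v)%E].

Definition dom_subdiff R : set V := [set w | subdiff R w !=set0].

Definition conjugate R (eta : V) : \bar K :=
  ereal_sup [set ((dot eta w)%:E - R w)%E | w in [set: V]].

Definition affine_hull S : set V :=
  [set x | exists (n : nat) (a : 'I_n -> K) (s : 'I_n -> V),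
     [/\ forall i, S (s i), \sum_(i < n) a i = 1
       & x = \sum_(i < n) a i *: s i]].

(* Interior of [S] for the topology induced on its affine hull. *)
Definition relint S : set V :=
  [set x | S x /\ within (affine_hull S) (nbhs x) S].

Definition J_op R S : set V := \bigcup_(x in S) relint (subdiff R x).

End Convex.

Section Strata.
Context {K : realType} {p : nat}.
Local Notation V := 'cV[K]_p.
Implicit Types (S D : set V) (M : set (set V)).

(* A stratification is given by its set of strata. *)
Definition stratification M D : Prop :=
  [/\ finite_set M, partition M id D
    & forall S S', M S -> M S' ->
        S `&` closure S' !=set0 -> S `<=` closure S'].

Definition strat_le (S S' : set V) : Prop := S `<=` closure S'.

(* Unspecified when [w] lies outside the stratified set. *)
Definition stratum_of M (w : V) : set V := pblock M id w.

(* "Decreasing" is taken in the sense of invertible maps between ordered sets: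
   [J_op R] reverses the order and so does its inverse [J_op (conjugate R)]. *)
Definition mirror_stratifiable (R : V -> \bar K) (M Ms : set (set V)) : Prop :=
  [/\ stratification M (dom_subdiff R),
      stratification Ms (dom_subdiff (conjugate R)),
      forall S, M S -> Ms (J_op R S) /\ J_op (conjugate R) (J_op R S) = S,
      forall S, Ms S -> M (J_op (conjugate R) S) /\
                        J_op R (J_op (conjugate R) S) = S
    & forall S S', M S -> M S' ->
        strat_le S S' <-> strat_le (J_op R S') (J_op R S)].

End Strata.

(* R^p * R with the product of the Borel sigma-algebras. *)
Notation sample_space K p :=
  (g_sigma_algebraType (@open 'cV[K]_p) * measurableTypeR K)%type.

Section Sampling.
Context {K : realType} {p : nat}.
Local Notation V := 'cV[K]_p.
Implicit Types rho : probability (sample_space K p) K.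

Definition inp (z : sample_space K p) : V := z.1.
Definition out (z : sample_space K p) : K := z.2.

Definition population_risk rho (w : V) : \bar K :=
  'E_rho[fun z => (dot w (inp z) - out z) ^+ 2].

Definition second_moment rho : 'M[K]_p :=
  \matrix_(i, j) fine 'E_rho[fun z => (inp z *m (inp z)^T) i j].

Definition dual_objective (Cdag : 'M[K]_p) (eta : V) : \bar K :=
  (dot (Cdag *m eta) eta)%:E.

Definition matrix_image (A : 'M[K]_p) : set V := range (fun v : V => A *m v).

(* [Z i], [i < n], are the first [n] observations. *)
Definition empirical_objective (R : V -> \bar K) (lambda : K) (n : nat)
    (Z : nat -> sample_space K p) (w : V) : \bar K :=
  (lambda%:E * R w +
   ((2 * n%:R)^-1 *
      \sum_(i < n) (dot (inp (Z i)) w - out (Z i)) ^+ 2)%R%:E)%E.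

End Sampling.

Definition mutually_independent {d d' : measure_display}
    {Omega : measurableType d} {T : measurableType d'} {K : realType}
    (P : probability Omega K) (Z : nat -> {RV P >-> T}) : Prop :=
  forall (s : {fset nat}) (A : nat -> set T), (forall i, measurable (A i)) ->
    P (\bigcap_(i in [set` s]) (Z i @^-1` A i)) =
    (\prod_(i <- s) P (Z i @^-1` A i))%E.

Definition iid_from {d d' : measure_display}
    {Omega : measurableType d} {T : measurableType d'} {K : realType}
    (P : probability Omega K) (rho : probability T K)
    (Z : nat -> {RV P >-> T}) : Prop :=
  mutually_independent Z /\
  forall i (A : set T), measurable A -> distribution P (Z i) A = rho A.

(* Main.v *)
(** Write [C], [u] for the population moments and [Cn], [un] for the empirical
    ones.  Almost surely the inputs lie in [Im C], and the upper half of the law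
    of the iterated logarithm bounds [Cn - C] and [Cn w0 - un] by
    [O(sqrt (ln (ln n) / n)) = o(lambda n)].  Optimality of the estimator [wn]
    then makes the [Im C]-component of [wn - w0] an [O(lambda n)], so that
    [R wn <= R w0 + o(1)], and uniqueness of [w0] forces [wn --> w0] by
    compactness of a sphere around [w0].  The certificate
    [eta_n = (un - Cn wn) / lambda n] is a subgradient of [R] at [wn] in [Im C],
    and monotonicity of the subdifferential gives
    [<eta_n - eta0, Cdag eta_n> <= o(1)], whose limit points in
    [subdiff R w0] can only be the minimal vector [eta0].  As there are finitely
    many strata, [wn --> w0] gives the first comparison, and [eta_n --> eta0]
    gives the second one through the decreasing bijection [J_op R].

    For the iterated-logarithm bound,
    [expR (x - x ^+ 2) <= 1 + x + x ^+ 2] turns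
    [t * S_n - t ^+ 2 * (\sum X_i ^+ 2 + n * E X ^+ 2)] into the logarithm of a
    nonnegative supermartingale for every [t], without truncating the [X_i]; a
    maximal inequality applies along dyadic blocks, and
    [\sum_(i < n) X_i ^+ 2 = O(n)] is a one-sided strong law. *)
Require Import Defs.
From HB Require Import structures.
From mathcomp Require Import all_boot all_order all_algebra finmap.
From mathcomp Require Import all_classical all_reals all_analysis.
From mathcomp Require Import measurable_realfun.
From mathcomp Require Import ring lra.

Set Implicit Arguments.
Unset Strict Implicit.
Unset Printing Implicit Defensive.

Import Order.TTheory GRing.Theory Num.Theory.
Import numFieldNormedType.Exports.

Local Open Scope classical_set_scope.
Local Open Scope ring_scope.

(** * Independence along a random recursion *)

(** Four moments of the data leave only a variance to the products [inp z i 0 * inp z j 0] and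
    [residual w0 z * inp z i 0]. The exponential bound must therefore be self-normalized: its random
    quadratic term is controlled by a first moment alone. Stopping and conditioning are expressed by
    a recursion driven by the sample, whose averaging over one step is Tonelli's theorem.

    The other obstacle is the kernel of [C], which the data never see. Membership of [eta0] in
    [Im C] makes every linear term pair with the projected error; along the kernel only convexity,
    semicontinuity and uniqueness remain.

    Probability serves to produce one almost sure event. On it the argument is deterministic and
    covers every minimizer at once, so no measurable choice of the estimator is involved. Finally,
    [eta_n] may lie on the relative boundary of [subdiff R wn], outside what [J_op] collects. The
    relative interior of a convex set is dense in it, so [eta_n] still lies in the closure of the
    dual stratum, which is enough for the order. *)

Section Markov_chain.
Context {d dS dT : measure_display} {Omega : measurableType d}
  {S : measurableType dS} {T : measurableType dT} {K : realType}.
Variables (P : probability Omega K) (rho : probability T K).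
Variables (Z : nat -> {RV P >-> T}) (hZ : iid_from rho Z).
Variables (h : S * T -> S) (mh : measurable_fun [set: S * T] h) (u0 : S).

(** State [k] depends on [Z 0], ..., [Z k.-1] only, hence is independent of [Z k]. Both the plain
    partial sums and the random walk frozen at a level are of this form. *)
Fixpoint chain (k : nat) (w : Omega) : S :=
  if k is k'.+1 then h (chain k' w, Z k' w) else u0.

Lemma measurable_chain k : measurable_fun setT (chain k).
Proof.
elim: k => [|k IH] /=; first exact: measurable_cst.
by apply: (measurableT_comp mh); apply/measurable_fun_pairP; split.
Qed.

HB.instance Definition _ k := isMeasurableFun.Build _ _ _ _ _ (measurable_chain k).

Lemma measurable_chain_pair k : measurable_fun setT (fun w => (chain k w, Z k w)).
Proof. apply/measurable_fun_pairP; split => //; exact: measurable_chain. Qed.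

Let pairZ k : {mfun Omega >-> (S * T)%type} :=
  HB.pack (fun w => (chain k w, Z k w))
    (isMeasurableFun.Build _ _ _ _ _ (measurable_chain_pair k)).

Let future (s : {fset nat}) (B : nat -> set T) := \bigcap_(i in [set` s]) (Z i @^-1` B i).

Let mfuture s B : (forall i, measurable (B i)) -> measurable (future s B).
Proof.
move=> mB; apply: fin_bigcap_measurable; first exact: finite_fset.
by move=> i _; rewrite -[X in measurable X]setTI; exact: measurable_funP.
Qed.

(** Rectangles determine a product measure. Independence at rank [k] is a premise because the lemma
    serves twice: inside the induction below, where only the induction hypothesis provides it, and
    after it. *)
Let law_pair k :
  (forall A (B : nat -> set T), (forall i, measurable (B i)) -> measurable A ->
    P (chain k @^-1` A `&` future [fset k]%fset B) =
    (P (chain k @^-1` A) * P (future [fset k]%fset B))%E) ->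
  forall X, measurable X ->
    (distribution P (chain k) \x rho)%E X = distribution P (pairZ k) X.
Proof.
move=> indep; apply: product_measure_unique => A B mA mB.
have futE : future [fset k]%fset (fun=> B) = Z k @^-1` B.
  apply/seteqP; split=> w; first by apply; rewrite /= inE.
  by move=> ? i /=; rewrite inE => /eqP ->.
transitivity (distribution P (chain k) A * distribution P (Z k) B)%E; last first.
  by rewrite (hZ.2 k B mB).
by rewrite /distribution /pushforward -futE -indep// futE.
Qed.

(* The induction needs all finite futures at once: on [future s B] the law of
   [(chain k, Z k)] is a multiple of a product measure. *)
Lemma chain_indep_future k (s : {fset nat}) (B : nat -> set T) A :
  (forall i, measurable (B i)) -> (forall i, i \in s -> (k <= i)%N) -> measurable A ->
  P (chain k @^-1` A `&` future s B) = (P (chain k @^-1` A) * P (future s B))%E.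
Proof.
elim: k s B A => [|k IH] s B A mB hs mA.
  have [Au|nAu] := pselect (A u0).
    rewrite (_ : chain 0 @^-1` A = setT); last by apply/seteqP; split.
    by rewrite setTI probability_setT mul1e.
  rewrite (_ : chain 0 @^-1` A = set0); last by apply/seteqP; split.
  by rewrite set0I measure0 mul0e.
have mF := mfuture s mB.
set F := future s B in mF *.
have PF0 : (0 <= fine (P F))%R by rewrite fine_ge0.
pose r : {nonneg K} := NngNum PF0.
have rE : (r%:num%:E = P F)%E by rewrite /r /= fineK// fin_num_measure.
pose lawU := distribution P (chain k).
pose m' := pushforward (mrestr P mF) (pairZ k).
(* The induction hypothesis for the future enlarged by [k] gives the equality on rectangles.
   Uniqueness of product measures extends it to [h @^-1] of [A], which is not a rectangle. *)
have key : forall X, measurable X -> (mscale r lawU \x rho)%E X = m' X.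
  apply: product_measure_unique => A1 B1 mA1 mB1.
  change (m' (A1 `*` B1) = ((r%:num%:E * lawU A1) * rho B1)%E).
  rewrite rE /m' /pushforward /mrestr.
  pose s' := (k |` s)%fset; pose B' i := if i == k then B1 else B i.
  have mB' i : measurable (B' i) by rewrite /B'; case: eqP.
  have ks : k \notin s by apply/negP => /hs; rewrite ltnn.
  have B'B i : i \in s -> B' i = B i.
    by rewrite /B'; case: eqP => // -> ki; rewrite ki in ks.
  have FE : future s' B' = Z k @^-1` B1 `&` F.
    apply/seteqP; split => w.
      move=> Hw; split; first by have := Hw k; rewrite /= /B' eqxx; apply; rewrite !inE eqxx.
      by move=> i /= si; have := Hw i; rewrite B'B//; apply => /=; rewrite !inE si orbT.
    move=> [w1 w2] i /=; rewrite !inE => /orP[/eqP ->|si]; first by rewrite /B' eqxx.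
    by rewrite B'B//; exact: w2.
  have -> : pairZ k @^-1` (A1 `*` B1) `&` F = chain k @^-1` A1 `&` future s' B'.
    by rewrite FE setIA.
  rewrite IH//; last first.
    by move=> i; rewrite !inE => /orP[/eqP ->//|/hs]; exact: ltnW.
  have -> : P (future s' B') = (rho B1 * P F)%E.
    rewrite (hZ.1 s' B' mB') big_fsetU1//= /B' eqxx.
    rewrite -(hZ.2 k B1 mB1); congr *%E.
    rewrite /F (hZ.1 s B mB); rewrite big_seq [RHS]big_seq.
    by apply: eq_bigr => i si; rewrite -/(B' i) B'B.
  rewrite /lawU /distribution /pushforward/=.
  by rewrite -[RHS]muleA [RHS]muleC -[RHS]muleA.
have mhA : measurable (h @^-1` A) by rewrite -[X in measurable X]setTI; exact: mh.
have e1 := key _ mhA.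
have -> : P (chain k.+1 @^-1` A `&` F) = m' (h @^-1` A) by [].
rewrite -e1.
rewrite /product_measure1 ge0_integral_mscale//; last first.
  exact: measurable_fun_xsection.
rewrite -rE muleC; congr (_ * _)%E.
have := law_pair _ mhA; rewrite /product_measure1; apply=> A1 B1 mB1 mA1.
by rewrite IH// => i; rewrite inE => /eqP ->.
Qed.

(** This replaces conditioning on the past: the pair has a product law, so Tonelli integrates the
    fresh observation first. *)
Lemma integral_chain_step k (f : S * T -> \bar K) : measurable_fun [set: S * T] f ->
  (forall x, 0 <= f x)%E ->
  (\int[P]_w f (chain k w, Z k w) =
   \int[P]_w \int[rho]_z f (chain k w, z))%E.
Proof.
move=> mf f0.
pose lawU := distribution P (chain k).
transitivity (\int[distribution P (pairZ k)]_x f x)%E.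
  by rewrite ge0_integral_distribution.
rewrite (@eq_measure_integral _ _ _ _ (lawU \x rho)%E); last first.
  move=> A mA _; apply/esym/law_pair => // A1 B1 mB1 mA1.
  by rewrite chain_indep_future// => i; rewrite inE => /eqP ->.
rewrite fubini_tonelli1//.
rewrite /lawU ge0_integral_distribution//.
  exact: measurable_fun_fubini_tonelli_F.
by move=> y; exact: integral_ge0.
Qed.

End Markov_chain.

Section Chain_inequalities.
Context {d dS dT : measure_display} {Omega : measurableType d}
  {S : measurableType dS} {T : measurableType dT} {K : realType}.
Variables (P : probability Omega K) (rho : probability T K).
Variables (Z : nat -> {RV P >-> T}) (hZ : iid_from rho Z).
Variables (h : S * T -> S) (mh : measurable_fun [set: S * T] h) (u0 : S).

(** A drift inequality. With [v = 0] it is the supermartingale property behind the maximal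
    inequality; with [phi u = u ^ 2] it is the additivity of variances behind Chebyshev's
    inequality. *)
Lemma integral_chain_le (phi : S -> \bar K) (v : K) n :
  measurable_fun setT phi -> (forall u, 0 <= phi u)%E -> 0 <= v ->
  (forall u, \int[rho]_z phi (h (u, z)) <= phi u + v%:E)%E ->
  (\int[P]_w phi (chain Z h u0 n w) <= phi u0 + (n%:R * v)%:E)%E.
Proof.
move=> mphi phi0 v0 step; elim: n => [|n IH] /=.
  by rewrite mul0r adde0 integral_cst//= probability_setT mule1.
have mphih : measurable_fun [set: S * T] (phi \o h) by exact: measurableT_comp.
have mchain k : measurable_fun setT (fun w => phi (chain Z h u0 k w)).
  exact: (measurableT_comp mphi (measurable_chain Z mh u0 k)).
rewrite (integral_chain_step hZ mh u0 n mphih)//; last by move=> ?; exact: phi0.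
apply: (@le_trans _ _ (\int[P]_w (phi (chain Z h u0 n w) + v%:E))%E).
  apply: ge0_le_integral => //.
  - by move=> w _; apply: integral_ge0 => z _; exact: phi0.
  - have mF := @measurable_fun_fubini_tonelli_F _ _ _ _ _ rho (phi \o h) mphih
      (fun x => phi0 (h x)).
    exact: (measurableT_comp mF (measurable_chain Z mh u0 n)).
  - exact: emeasurable_funD.
  - by move=> w _; exact: step.
rewrite ge0_integralD//.
rewrite integral_cst//= probability_setT mule1 -natr1 mulrDl mul1r EFinD addeA.
by rewrite leeD2r.
Qed.

End Chain_inequalities.

Section Expectation_tools.
Context {d : measure_display} {T : measurableType d} {K : realType}.
Variable P : probability T K.

Lemma markov_ge0 (g : T -> K) (a : K) : measurable_fun setT g ->
  (forall x, 0 <= g x) -> 0 < a ->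
  (P [set x | (a <= g x)%R] <= (a^-1)%:E * \int[P]_x (g x)%:E)%E.
Proof.
move=> mg g0 a0.
have mEg : measurable_fun setT (EFin \o g) by exact/measurable_EFinP.
have := @le_integral_abse _ _ _ P setT measurableT (EFin \o g) a mEg a0.
rewrite setTI -lee_pdivlMl//.
under eq_set do rewrite /= lee_fin ger0_norm//.
by under eq_integral do rewrite /= ger0_norm//.
Qed.

Lemma sqr_integrable_integrable (g : T -> K) : measurable_fun setT g ->
  (\int[P]_x (g x ^+ 2)%:E < +oo)%E -> P.-integrable setT (EFin \o g).
Proof.
move=> mg g2; have mg2 : measurable_fun setT (fun x => g x ^+ 2).
  exact: measurable_funX.
apply: (@le_integrable _ _ _ P setT measurableT _ (fun x => (1 + g x ^+ 2)%:E)).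
- exact/measurable_EFinP.
- move=> x _ /=; rewrite lee_fin [leRHS]ger0_norm ?addr_ge0 ?sqr_ge0//.
  rewrite ler_norml; apply/andP; split; nra.
apply/integrableP; split; first by apply/measurable_EFinP; exact: measurable_funD.
under eq_integral do rewrite /= ger0_norm ?addr_ge0 ?sqr_ge0// EFinD.
rewrite ge0_integralD//=; last 2 first.
  by move=> x _; rewrite lee_fin sqr_ge0.
  exact/measurable_EFinP.
by rewrite integral_cst//= probability_setT mul1e lte_add_pinfty// ltry.
Qed.

Lemma ge0_integrable (g : T -> K) : measurable_fun setT g ->
  (forall x, 0 <= g x) -> (\int[P]_x (g x)%:E < +oo)%E ->
  P.-integrable setT (EFin \o g).
Proof.
move=> mg g0 gi; apply/integrableP; split; first exact/measurable_EFinP.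
by under eq_integral do rewrite /= ger0_norm//.
Qed.

(** Each [F k] only has to sit inside a small measurable event, which is the form delivered by the
    maximal inequality. *)
Lemma borel_cantelli_ae (F : nat -> set T) (b : nat -> K) (c : K) :
  (forall k, exists2 E, measurable E & F k `<=` E /\ (P E <= (b k)%:E)%E) ->
  (forall n, \sum_(k < n) b k <= c) ->
  {ae P, forall w, \forall k \near \oo, ~ F k w}.
Proof.
move=> hF bc.
have /choice[E hE] : forall k, exists E, [/\ measurable E, F k `<=` E & (P E <= (b k)%:E)%E].
  by move=> k; have [E mE [FE PE]] := hF k; exists E.
have mE k : measurable (E k) by have [] := hE k.
exists (lim_sup_set E); split.
- by apply: bigcap_measurable => // k _; exact: bigcup_measurable.
- apply: lim_sup_set_cvg0 => //.
  apply: (@le_lt_trans _ _ c%:E); last exact: ltry.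
  apply: lime_le; first by apply: is_cvg_ereal_nneg_natsum_cond.
  apply: nearW => n; rewrite big_mkord.
  apply: (@le_trans _ _ (\sum_(k < n) (b k)%:E)%E); last by rewrite sumEFin lee_fin.
  by apply: lee_sum => k _; have [] := hE k.
move=> w /=; apply: contra_notP => nw.
have [N nN] : exists N, forall j, (N <= j)%N -> ~ E j w.
  apply: contrapT => h; apply: nw => n _.
  apply: contrapT => h'; apply: h; exists n => j nj Ejw; apply: h'.
  by exists j.
by exists N => // k /= Nk Fk; apply: (nN k Nk); have [_ + _] := hE k; apply.
Qed.

End Expectation_tools.

Section Partial_sums.
Context {d dT : measure_display} {Omega : measurableType d}
  {T : measurableType dT} {K : realType}.
Variables (P : probability Omega K) (rho : probability T K).
Variables (Z : nat -> {RV P >-> T}) (hZ : iid_from rho Z).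

Definition psum (xi : T -> K) (n : nat) (w : Omega) : K := \sum_(i < n) xi (Z i w).

Lemma psumS xi n w : psum xi n.+1 w = psum xi n w + xi (Z n w).
Proof. by rewrite /psum big_ord_recr. Qed.

(** Ville's inequality. The exponential of the stopped walk has mean at most 1, and Markov's
    inequality at the single time [n] then accounts for all earlier times. *)
Lemma exp_maximal_inequality (xi : T -> K) (a : K) (n : nat) :
  measurable_fun setT xi -> (\int[rho]_z (expR (xi z))%:E <= 1)%E ->
  exists2 E, measurable E &
    [set w | exists2 k, (k <= n)%N & a <= psum xi k w] `<=` E /\
    (P E <= (expR (- a))%:E)%E.
Proof.
move=> mxi hxi.
(* The chain is the random walk frozen once it reaches [a]. *)
pose h (uz : K * T) : K := if a <= uz.1 then uz.1 else uz.1 + xi uz.2.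
have mh : measurable_fun [set: K * T] h.
  apply: measurable_fun_if => //.
  - exact: measurable_fun_ler.
  - exact: measurable_funTS.
  - apply: measurable_funTS; apply: measurable_funD => //.
    exact: (measurableT_comp mxi).
pose U n w : K := chain Z h 0 n w.
have mU k : measurable_fun setT (U k) := measurable_chain Z mh 0 k.
have stopped k w : a <= U k w \/ U k w = psum xi k w.
  elim: k => [|k [IH|IH]]; first by right; rewrite /U/= /psum big_ord0.
    by left; rewrite /U/= /h/= IH.
  rewrite /U/= /h/= -/(U k w); case: ifPn => [|_]; first by left.
  by right; rewrite psumS IH.
have hit k w : (exists2 j, (j <= k)%N & a <= psum xi j w) -> a <= U k w.
  elim: k => [|k IH] [j].
    by rewrite leqn0 => /eqP ->; rewrite /psum big_ord0.
  rewrite leq_eqVlt => /orP[/eqP -> |]; last first.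
    rewrite ltnS => jk aj; have aU : a <= U k w by apply: IH; exists j.
    by rewrite /U/= /h/= -/(U k w) aU.
  move=> aj; rewrite /U/= /h/= -/(U k w); case: ifPn => // /negP nU.
  by have [//|->] := stopped k w; rewrite -psumS.
exists [set w | expR a <= expR (U n w)].
  rewrite -[X in measurable X]setTI.
  apply: (@measurable_fun_ler _ _ _ setT (cst (expR a)) (expR \o U n)) => //.
  exact: (measurableT_comp (@measurable_expR K)).
split; first by move=> w /= /hit; rewrite ler_expR.
have mexpU : measurable_fun setT (fun w => expR (U n w)).
  exact: (measurableT_comp (@measurable_expR K) (mU n)).
apply: le_trans (markov_ge0 P mexpU (fun=> expR_ge0 _) (expR_gt0 a)) _.
rewrite expRN -[leRHS]mule1 lee_pmul2l//= ?lte_fin ?invr_gt0 ?expR_gt0//.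
have := @integral_chain_le _ _ _ _ _ _ _ P rho Z hZ h mh 0 (fun u => (expR u)%:E) 0 n.
rewrite mulr0 adde0 expR0; apply=> //.
- by apply/measurable_EFinP; exact: measurable_expR.
move=> u; rewrite adde0 /h /=; case: (a <= u).
  by rewrite integral_cst//= probability_setT mule1.
under eq_integral do rewrite expRD EFinM.
rewrite ge0_integralZl_EFin ?expR_ge0//.
- by rewrite -[leRHS]mule1 lee_pmul2l//= lte_fin expR_gt0.
- by apply/measurable_EFinP; exact: measurableT_comp.
Qed.

Lemma centered_psum_sqr (xi : T -> K) (v : K) n : measurable_fun setT xi ->
  rho.-integrable setT (EFin \o xi) -> (\int[rho]_z (xi z)%:E = 0)%E ->
  (\int[rho]_z (xi z ^+ 2)%:E <= v%:E)%E ->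
  (\int[P]_w (psum xi n w ^+ 2)%:E <= (n%:R * v)%:E)%E.
Proof.
move=> mxi ixi xi0 xi2.
pose h (uz : K * T) : K := uz.1 + xi uz.2.
have mh : measurable_fun [set: K * T] h.
  by apply: measurable_funD => //; exact: (measurableT_comp mxi).
have chainE k w : chain Z h 0 k w = psum xi k w.
  by elim: k => [|k IH] /=; rewrite ?psumS -?IH// /psum big_ord0.
have mxi2 : measurable_fun setT (fun z => (xi z ^+ 2)%:E).
  by apply/measurable_EFinP; exact: measurable_funX.
have ixi2 : rho.-integrable setT (fun z => (xi z ^+ 2)%:E).
  apply: (ge0_integrable (g := fun z => xi z ^+ 2)).
  - exact: measurable_funX.
  - by move=> z; exact: sqr_ge0.
  - by apply: le_lt_trans xi2 _; exact: ltry.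
have v0 : 0 <= v.
  rewrite -lee_fin; apply: le_trans xi2; apply: integral_ge0 => z _.
  by rewrite lee_fin sqr_ge0.
under eq_integral do rewrite -chainE.
have := @integral_chain_le _ _ _ _ _ _ _ P rho Z hZ h mh 0 (fun u => (u ^+ 2)%:E) v n.
rewrite expr0n/= add0e; apply => //.
- by apply/measurable_EFinP; exact: measurable_funX.
- by move=> u; rewrite lee_fin sqr_ge0.
move=> u; rewrite /h/=.
have -> : (\int[rho]_z ((u + xi z) ^+ 2)%:E =
   \int[rho]_z (((u ^+ 2)%:E + (u *+ 2)%:E * (xi z)%:E) + (xi z ^+ 2)%:E))%E.
  apply: eq_integral => z _; rewrite -!EFinM -!EFinD; congr EFin; ring.
have ic : rho.-integrable setT (fun _ : T => (u ^+ 2)%:E).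
  exact: finite_measure_integrable_cst.
have iz : rho.-integrable setT (fun z => ((u *+ 2)%:E * (xi z)%:E)%E).
  exact: integrableZl.
rewrite integralD//; last exact: integrableD.
rewrite integralD// integralZl// xi0 mule0 adde0.
by rewrite integral_cst//= probability_setT mule1 leeD2l.
Qed.

End Partial_sums.

(** * A one-sided strong law under a first moment *)

Section Linear_growth.
Context {K : realType}.

(** The terms are geometric on both sides of [w]: equal to [2 ^ k] below it and to [w ^ 2 / 2 ^ k]
    above it, each side contributing at most [2 * w]. Integrated over [W], this pays for the
    variances at all dyadic scales with one first moment. *)
Lemma dyadic_truncation_sum (w : K) n : 0 <= w ->
  \sum_(k < n) Num.min w (2 ^+ k) ^+ 2 / 2 ^+ k <= 4 * w.
Proof.
move=> w0.
(* A telescoping potential: the truncated term at [m] is at most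
   [phi m - phi (2 * m)]. *)
pose phi (m : K) := if m <= w then 4 * w - m else 2 * w ^+ 2 / m.
have phi_step m : 0 < m -> Num.min w m ^+ 2 / m <= phi m - phi (2 * m).
  move=> m0; rewrite /phi; have [mw|wm] := leP m w.
    rewrite expr2 mulfK ?gt_eqF//; case: ifPn => [_|].
      by lra.
    rewrite -ltNge => w2m.
    have -> : 2 * w ^+ 2 / (2 * m) = w ^+ 2 / m.
      by field; rewrite gt_eqF.
    have : w ^+ 2 / m <= 2 * w by rewrite ler_pdivrMr// expr2; nra.
    by lra.
  rewrite ifF; last by apply/negbTE; rewrite -ltNge; lra.
  have -> : 2 * w ^+ 2 / (2 * m) = w ^+ 2 / m by field; rewrite gt_eqF.
  by have : 2 * w ^+ 2 / m = w ^+ 2 / m + w ^+ 2 / m by [field; rewrite gt_eqF]; lra.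
have phi0 m : 0 < m -> 0 <= phi m.
  move=> m0; rewrite /phi; case: ifPn => [mw|_]; first lra.
  by rewrite divr_ge0 ?mulr_ge0 ?sqr_ge0// ltW.
have phi1 : phi 1 <= 4 * w.
  rewrite /phi; case: ifPn => [_|]; first lra.
  by rewrite -ltNge divr1 expr2 => w1; nra.
apply: le_trans phi1; rewrite -[leRHS]subr0.
apply: (@le_trans _ _ (phi 1 - phi (2 ^+ n))); last first.
  by rewrite lerD2l lerN2 phi0// exprn_gt0.
elim: n => [|n IH]; first by rewrite big_ord0 expr0 subrr.
rewrite big_ord_recr/=.
have e0 : 0 < 2 ^+ n :> K by rewrite exprn_gt0.
by apply: (le_trans (lerD IH (phi_step _ e0))); rewrite addrA subrK (exprS 2 n).
Qed.

Context {d dT : measure_display} {Omega : measurableType d}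
  {T : measurableType dT}.
Variables (P : probability Omega K) (rho : probability T K).
Variables (Z : nat -> {RV P >-> T}) (hZ : iid_from rho Z).

Lemma psum_linear_growth (W : T -> K) : measurable_fun setT W ->
  (forall z, 0 <= W z) -> (\int[rho]_z (W z)%:E < +oo)%E ->
  {ae P, forall w, exists B, \forall n \near \oo, psum Z W n w <= B * n%:R}.
Proof.
move=> mW W0 Woo.
pose mu := fine (\int[rho]_z (W z)%:E)%E.
have iW : rho.-integrable setT (EFin \o W) by exact: ge0_integrable.
have muE : (\int[rho]_z (W z)%:E = mu%:E)%E.
  by rewrite fineK// (integrable_fin_num measurableT iW).
pose V k z : K := Num.min (W z) (2 ^+ k).
have V0 k z : 0 <= V k z by rewrite le_min W0 exprn_ge0.
have VW k z : V k z <= W z by rewrite ge_min lexx.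
have V2 k z : V k z <= 2 ^+ k by rewrite ge_min lexx orbT.
have mV k : measurable_fun setT (V k) by apply: measurable_minr.
have iV k : rho.-integrable setT (EFin \o V k).
  apply: le_integrable iW => //; first exact/measurable_EFinP.
  by move=> z _; rewrite /= lee_fin !ger0_norm.
pose m k := fine (\int[rho]_z (V k z)%:E)%E.
have mE k : (\int[rho]_z (V k z)%:E = (m k)%:E)%E.
  by rewrite fineK// (integrable_fin_num measurableT (iV k)).
have mmu k : m k <= mu.
  rewrite -lee_fin -mE -muE; apply: ge0_le_integral => //.
  - by move=> z _; rewrite lee_fin.
  - exact/measurable_EFinP.
  - exact/measurable_EFinP.
  - by move=> z _; rewrite lee_fin.
pose Q k z : K := V k z ^+ 2 / 2 ^+ k.
have mQ k : measurable_fun setT (Q k).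
  by apply: measurable_funM => //; exact: measurable_funX.
have Q0 k z : 0 <= Q k z by rewrite divr_ge0 ?sqr_ge0 ?exprn_ge0.
have QW k z : Q k z <= W z.
  rewrite ler_pdivrMr ?exprn_gt0// expr2 ler_pM//.
have iQ k : rho.-integrable setT (EFin \o Q k).
  apply: le_integrable iW => //; first exact/measurable_EFinP.
  by move=> z _; rewrite /= lee_fin !ger0_norm.
pose beta k := fine (\int[rho]_z (Q k z)%:E)%E.
have betaE k : (\int[rho]_z (Q k z)%:E = (beta k)%:E)%E.
  by rewrite fineK// (integrable_fin_num measurableT (iQ k)).
have sum_beta n : \sum_(k < n) beta k <= 4 * mu.
  rewrite -lee_fin -sumEFin EFinM -muE -ge0_integralZl_EFin//; last 2 first.
    by move=> z _; rewrite lee_fin.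
    exact/measurable_EFinP.
  under eq_bigr do rewrite -betaE.
  rewrite -ge0_integral_sum//; last 2 first.
    by move=> k; exact/measurable_EFinP.
    by move=> k z _; rewrite lee_fin.
  apply: ge0_le_integral => //.
  - by move=> z _; apply: sume_ge0 => k _; rewrite lee_fin.
  - by apply: emeasurable_sum => k; exact/measurable_EFinP.
  - by apply/measurable_EFinP; exact: measurable_funM.
  - by move=> z _; rewrite sumEFin -EFinM lee_fin; exact: dyadic_truncation_sum.
(* Truncating [W] at [2 ^ k] on the block of length [2 ^ k] makes the Chebyshev
   bounds summable, with only a first moment; monotonicity fills the gaps. *)
pose F k := [set w | (mu + 1) * 2 ^+ k <= psum Z W (2 ^ k) w].
have : {ae P, forall w, \forall k \near \oo, ~ F k w}.
  (* One [beta k] bounds the probability that some observation of the block reaches the truncation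
     level [2 ^ k], the other that the centred truncated sum deviates by [2 ^ k]. *)
  apply: (@borel_cantelli_ae _ _ _ P F (fun k => beta k + beta k) (8 * mu)); last first.
    by move=> n; rewrite big_split/=; have := sum_beta n; lra.
  move=> k.
  have V2E : (\int[rho]_z (V k z ^+ 2)%:E = (beta k * 2 ^+ k)%:E)%E.
    rewrite EFinM -betaE -ge0_integralZr//; last 2 first.
      exact/measurable_EFinP.
      by move=> z _; rewrite lee_fin.
    by apply: eq_integral => z _; rewrite -EFinM /Q divfK// expf_neq0.
  have k0 : 0 < 2 ^+ k :> K by rewrite exprn_gt0.
  pose xi z := V k z - m k.
  have mxi : measurable_fun setT xi by apply: measurable_funB.
  have im : rho.-integrable setT (fun _ : T => (m k)%:E).
    exact: finite_measure_integrable_cst.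
  have ixi : rho.-integrable setT (EFin \o xi).
    exact: (integrableB measurableT (iV k) im).
  have xi0 : (\int[rho]_z (xi z)%:E = 0)%E.
    under eq_integral do rewrite EFinB.
    rewrite integralB_EFin// mE integral_cst//= probability_setT mule1.
    by rewrite subee.
  have iV2 : rho.-integrable setT (fun z => (V k z ^+ 2)%:E).
    apply: (ge0_integrable (g := fun z => V k z ^+ 2)).
    - exact: measurable_funX.
    - by move=> z; exact: sqr_ge0.
    - by rewrite V2E ltry.
  have xi2 : (\int[rho]_z (xi z ^+ 2)%:E <= (beta k * 2 ^+ k)%:E)%E.
    rewrite -V2E.
    have -> : (\int[rho]_z (xi z ^+ 2)%:E =
       \int[rho]_z (((V k z ^+ 2)%:E - (m k *+ 2)%:E * (V k z)%:E) + (m k ^+ 2)%:E))%E.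
      apply: eq_integral => z _; rewrite -!EFinM -EFinB -!EFinD /xi; congr EFin; ring.
    have iz : rho.-integrable setT (fun z => ((m k *+ 2)%:E * (V k z)%:E)%E).
      exact: (integrableZl measurableT (m k *+ 2) (iV k)).
    have ic : rho.-integrable setT (fun _ : T => (m k ^+ 2)%:E).
      exact: finite_measure_integrable_cst.
    rewrite integralD//; last exact: integrableB.
    rewrite integralB// (integralZl measurableT (iV k))/= mE V2E integral_cst//= probability_setT mule1.
    by rewrite -!EFinD lee_fin; have := sqr_ge0 (m k); lra.
  have mps : measurable_fun setT (fun w => psum Z xi (2 ^ k) w ^+ 2).
    apply: measurable_funX; apply: measurable_sum => i.
    exact: (measurableT_comp mxi).
  pose E1 := \bigcup_(i < (2 ^ k)%N) (Z i @^-1` [set z | (4 ^+ k <= V k z ^+ 2)%R]).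
  pose E2 := [set w | (4 ^+ k <= psum Z xi (2 ^ k) w ^+ 2)%R].
  have k4 : 4 ^+ k = 2 ^+ k ^+ 2 :> K by rewrite -exprM mulnC exprM; congr (_ ^+ _); lra.
  have k40 : 0 < 4 ^+ k :> K by rewrite exprn_gt0.
  have mset : measurable [set z | (4 ^+ k <= V k z ^+ 2)%R].
    rewrite -[X in measurable X]setTI.
    apply: (@measurable_fun_ler _ _ _ setT (cst (4 ^+ k)) (fun z => V k z ^+ 2)) => //.
    exact: measurable_funX.
  have mZ i : measurable (Z i @^-1` [set z | (4 ^+ k <= V k z ^+ 2)%R]).
    by rewrite -[X in measurable X]setTI; exact: measurable_funP.
  have mE1 : measurable E1 by exact: bigcup_measurable.
  have mE2 : measurable E2.
    rewrite -[X in measurable X]setTI.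
    exact: (@measurable_fun_ler _ _ _ setT (cst (4 ^+ k)) (fun w => psum Z xi (2 ^ k) w ^+ 2)).
  exists (E1 `|` E2); first exact: measurableU.
  split.
    move=> w /= Fw; apply: contrapT => /not_orP[nE1 nE2]; move: Fw; rewrite /F/=.
    apply/negP; rewrite -ltNge.
    have VWi i : (i < 2 ^ k)%N -> V k (Z i w) = W (Z i w).
      move=> ik; rewrite /V; apply/min_idPl; apply: contrapT => /negP.
      rewrite -ltNge => hW; apply: nE1; exists i => //=.
      by rewrite /V min_r ?k4// ltW.
    have -> : psum Z W (2 ^ k) w = psum Z xi (2 ^ k) w + m k * 2 ^+ k.
      rewrite /psum /xi big_split/= sumrN -[in RHS](natrX _ 2 k).
      rewrite sumr_const card_ord mulr_natr subrK.
      by apply: eq_bigr => i _; rewrite VWi.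
    move/negP: nE2; rewrite -ltNge k4 => nE2.
    have : psum Z xi (2 ^ k) w < 2 ^+ k.
      rewrite ltNge; apply/negP => h; move: nE2; apply/negP; rewrite -leNgt.
      by rewrite ler_sqr// nnegrE ltW// (lt_le_trans k0).
    by have := mmu k; nra.
  apply: (@le_trans _ _ (P E1 + P E2)%E); first exact: measureU2.
  rewrite EFinD; apply: leeD.
    rewrite /E1 bigcup_mkord.
    have mZ' i : (i < 2 ^ k)%N -> measurable (Z i @^-1` [set z | (4 ^+ k <= V k z ^+ 2)%R]).
      by move=> _; exact: mZ.
    apply: (le_trans (Boole_inequality P mZ')).
    have mk : measurable_fun setT (fun z => V k z ^+ 2) by exact: measurable_funX.
    have := markov_ge0 rho mk (fun z => sqr_ge0 _) k40.
    rewrite V2E -EFinM => hm.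
    apply: (@le_trans _ _ (\sum_(i < 2 ^ k) ((4 ^+ k)^-1 * (beta k * 2 ^+ k))%:E)%E).
      apply: lee_sum => i _; apply: le_trans hm.
      by rewrite -(hZ.2 i _ mset).
    rewrite sumEFin lee_fin sumr_const card_ord -[leLHS]mulr_natr natrX k4.
    by rewrite le_eqVlt; apply/orP; left; apply/eqP; field; rewrite gt_eqF.
  apply: le_trans (markov_ge0 P mps (fun w => sqr_ge0 _) k40) _.
  rewrite -lee_pdivlMl ?invr_gt0// invrK.
  apply: le_trans (centered_psum_sqr hZ _ mxi ixi xi0 xi2) _.
  by rewrite -EFinM lee_fin natrX k4; nra.
(* The factor 2 is the cost of rounding [n] up to a power [2 ^ k <= 2 * n]. *)
apply: filterS => w [N _ hN]; exists (2 * (mu + 1)).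
exists (2 ^ N).+2 => // n /= Nn.
have n1 : (1 < n)%N by apply: leq_trans Nn.
set k := up_log 2 n.
have nk : (n <= 2 ^ k)%N by exact: up_logP.
have kn : (2 ^ k <= 2 * n)%N.
  have := up_log_gtn (leqnn 2) n1.
  have : (0 < k)%N by rewrite up_log_gt0.
  by rewrite -/k; case: k {nk} => // k _ /=; rewrite expnS leq_pmul2l// => /ltnW.
have Nk : (N <= k)%N.
  rewrite leqNgt; apply/negP => kN.
  have : (2 ^ k < 2 ^ N)%N by rewrite ltn_exp2l.
  move/(leq_ltn_trans (leq_trans Nn nk)).
  by rewrite ltnNge (leqW (leqnSn _)).
have /negP := hN k Nk; rewrite -ltNge => hk.
have mono : psum Z W n w <= psum Z W (2 ^ k) w.
  rewrite /psum -!(big_mkord xpredT (fun i => W (Z i w))).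
  rewrite (big_cat_nat (leq0n n) nk)/= lerDl.
  by rewrite sumr_ge0.
have mu0 : 0 <= mu by rewrite fine_ge0// integral_ge0// => z _; rewrite lee_fin.
have : 2 ^+ k <= 2 * n%:R :> K by rewrite -natrX -natrM ler_nat.
by nra.
Qed.

End Linear_growth.

(** * The upper half of the law of the iterated logarithm *)

Section Iterated_logarithm.
Context {d dT : measure_display} {Omega : measurableType d}
  {T : measurableType dT} {K : realType}.
Variables (P : probability Omega K) (rho : probability T K).
Variables (Z : nat -> {RV P >-> T}) (hZ : iid_from rho Z).

(** Inverting [1 + y <= expR y] at [y = x ^ 2 - x] gives the upper bound [1 / (1 - x + x ^ 2)], and
    [(1 + x + x ^ 2) * (1 - x + x ^ 2) = 1 + x ^ 2 + x ^ 4 >= 1]. *)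
Lemma expR_sub_sqr_le (x : K) : expR (x - x ^+ 2) <= 1 + x + x ^+ 2.
Proof.
have e := expR_ge1Dx (- (x - x ^+ 2)); rewrite expRN in e.
have pos : 0 < 1 - x + x ^+ 2 by nra.
have e1 : expR (x - x ^+ 2) <= (1 - x + x ^+ 2)^-1.
  rewrite -[leLHS]invrK lef_pV2 ?posrE ?invr_gt0 ?expR_gt0//.
  by apply: le_trans e; lra.
apply: le_trans e1 _.
rewrite -[leLHS]div1r ler_pdivrMr//.
have : (1 + x + x ^+ 2) * (1 - x + x ^+ 2) = 1 + x ^+ 2 + (x ^+ 2) ^+ 2 by ring.
by move=> ->; have := sqr_ge0 x; have := sqr_ge0 (x ^+ 2); lra.
Qed.

Lemma ln2_ge_half : 2^-1 <= ln 2 :> K.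
Proof.
rewrite -ler_expR lnK ?posrE//.
rewrite -[leLHS]invrK -expRN -[leRHS]invrK lef_pV2 ?posrE ?expR_gt0//.
by apply: le_trans (expR_ge1Dx _); lra.
Qed.

(** Telescoping of [1 / (j + 1) - 1 / (j + 2)]. The summands are the probabilities
    [expR (- 2 * ln (j + 2))] allotted to the dyadic blocks. *)
Lemma sum_inv_sqr_le n : \sum_(j < n) ((j.+2)%:R ^+ 2)^-1 <= 1 :> K.
Proof.
apply: (@le_trans _ _ (1 - (n.+1%:R)^-1)); last by rewrite gerBl invr_ge0.
elim: n => [|n IH]; first by rewrite big_ord0 invr1 subrr.
rewrite big_ord_recr/=.
have n1 : 0 < n.+1%:R :> K by [].
have n2 : n.+2%:R = n.+1%:R + 1 :> K by rewrite natr1.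
have : (n.+2%:R ^+ 2)^-1 <= (n.+1%:R)^-1 - (n.+2%:R)^-1 :> K.
  have -> : (n.+1%:R)^-1 - (n.+2%:R)^-1 = (n.+1%:R * n.+2%:R)^-1 :> K.
    by rewrite n2; field; rewrite !gt_eqF//; lra.
  rewrite lef_pV2 ?posrE ?exprn_gt0 ?mulr_gt0//.
  by rewrite expr2 ler_pM2r// n2; lra.
by move=> h; apply: (le_trans (lerD IH h)); rewrite addrA subrK.
Qed.

(** From [2 ^ (j - 1) <= n] and [ln 2 >= 1 / 2] one gets [ln n >= (j - 1) / 2], whose square exceeds
    [j + 2] for these [j]; the square becomes the factor 2 outside the logarithm. *)
Lemma ln_dyadic_le n j : (9 < j)%N -> (2 ^ j <= 2 * n)%N ->
  ln j.+2%:R <= ln (ln n%:R) *+ 2 :> K.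
Proof.
move=> j9 jn.
have n0 : 0 < n%:R :> K.
  rewrite ltr0n; case: n jn => //; rewrite muln0 leqn0 expn_eq0//.
have nge : 2 ^+ j.-1 <= n%:R :> K.
  rewrite -natrX ler_nat -(@leq_pmul2l 2)// -expnS prednK//.
  exact: leq_ltn_trans j9.
have lnn : j.-1%:R / 2 <= ln n%:R :> K.
  apply: (@le_trans _ _ (ln (2 ^+ j.-1))); last first.
    by rewrite ler_ln ?posrE// exprn_gt0.
  by rewrite lnXn// -[leRHS]mulr_natl ler_wpM2l//; exact: ln2_ge_half.
have j1 : j%:R = j.-1%:R + 1 :> K.
  by rewrite natr1 prednK//; exact: leq_ltn_trans j9.
have j9' : 9 <= j.-1%:R :> K.
  by rewrite (ler_nat _ 9); case: j j9 {jn nge lnn j1}.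
have ln0 : 0 < ln n%:R :> K by lra.
rewrite -lnXn// ler_ln ?posrE ?exprn_gt0//.
have -> : j.+2%:R = j.-1%:R + 3 :> K by rewrite -addn2 natrD j1; lra.
by rewrite expr2; nra.
Qed.

(** At [x = t * X] the elementary bound integrates to [1 + t ^ 2 * s2], since [X] is centred. The
    last term of the exponent compensates exactly this, through [1 + y <= expR y]. *)
Lemma exp_supermartingale_increment (X : T -> K) (s2 t : K) :
  measurable_fun setT X -> (\int[rho]_z (X z)%:E = 0)%E ->
  (\int[rho]_z (X z ^+ 2)%:E = s2%:E)%E ->
  (\int[rho]_z (expR (t * X z - t ^+ 2 * X z ^+ 2 - t ^+ 2 * s2))%:E <= 1)%E.
Proof.
move=> mX X0 X2.
have iX : rho.-integrable setT (EFin \o X).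
  by apply: sqr_integrable_integrable => //; rewrite X2 ltry.
have mX2 : measurable_fun setT (fun z => X z ^+ 2) by exact: measurable_funX.
have iX2 : rho.-integrable setT (fun z => (X z ^+ 2)%:E).
  apply: (ge0_integrable (g := fun z => X z ^+ 2)) => //.
  - by move=> z; exact: sqr_ge0.
  - by rewrite X2 ltry.
have mt : measurable_fun setT (fun z => t * X z) by exact: measurable_funM.
have mt2 : measurable_fun setT (fun z => t ^+ 2 * X z ^+ 2) by exact: measurable_funM.
have ms : measurable_fun setT (fun z => 1 + t * X z + t ^+ 2 * X z ^+ 2).
  by apply: measurable_funD => //; exact: measurable_funD.
have pos z : 0 <= 1 + t * X z + t ^+ 2 * X z ^+ 2.
  rewrite -exprMn; set y := t * X z; have := sqr_ge0 (y + 2^-1); nra.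
apply: (@le_trans _ _ (\int[rho]_z ((expR (- (t ^+ 2 * s2)))%:E *
    (1 + t * X z + t ^+ 2 * X z ^+ 2)%:E))%E).
  apply: ge0_le_integral => //.
  - apply/measurable_EFinP; apply: measurableT_comp => //.
    by apply: measurable_funB => //; exact: measurable_funB.
  - by apply/measurable_EFinP; exact: measurable_funM.
  - move=> z _; rewrite -EFinM lee_fin expRD mulrC ler_wpM2l ?expR_ge0//.
    by rewrite -exprMn expR_sub_sqr_le.
rewrite ge0_integralZl_EFin ?expR_ge0//; last 2 first.
  by move=> z _; rewrite lee_fin.
  exact/measurable_EFinP.
have -> : (\int[rho]_z (1 + t * X z + t ^+ 2 * X z ^+ 2)%:E =
   \int[rho]_z ((1%:E + t%:E * (X z)%:E) + (t ^+ 2)%:E * (X z ^+ 2)%:E))%E.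
  by apply: eq_integral => z _; rewrite -!EFinM -!EFinD.
have ic : rho.-integrable setT (fun _ : T => 1%:E).
  exact: finite_measure_integrable_cst.
have iz := integrableZl measurableT t iX.
have iz2 := integrableZl measurableT (t ^+ 2) iX2.
rewrite integralD//; last exact: (integrableD measurableT ic iz).
rewrite (integralD measurableT ic iz) (integralZl measurableT iX)/=.
rewrite (integralZl measurableT iX2) X0 X2 mule0 adde0.
rewrite integral_cst//= probability_setT mule1.
change ((expR (- (t ^+ 2 * s2)))%:E * (1 + t ^+ 2 * s2)%:E <= 1%:E)%E.
rewrite -EFinM lee_fin.
rewrite expRN mulrC ler_pdivrMr ?expR_gt0// mul1r.
exact: expR_ge1Dx.
Qed.

Lemma psum_iterated_log_bound (X : T -> K) : measurable_fun setT X ->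
  (\int[rho]_z (X z)%:E = 0)%E -> (\int[rho]_z (X z ^+ 2)%:E < +oo)%E ->
  {ae P, forall w, exists B, \forall n \near \oo,
     psum Z X n w <= B * Num.sqrt (n%:R * ln (ln n%:R))}.
Proof.
move=> mX X0 X2oo.
pose s2 := fine (\int[rho]_z (X z ^+ 2)%:E)%E.
have mX2 : measurable_fun setT (fun z => X z ^+ 2) by exact: measurable_funX.
have X2 : (\int[rho]_z (X z ^+ 2)%:E = s2%:E)%E.
  rewrite fineK// ge0_fin_numE//; apply: integral_ge0 => z _.
  by rewrite lee_fin sqr_ge0.
have s20 : 0 <= s2.
  by rewrite fine_ge0//; apply: integral_ge0 => z _; rewrite lee_fin sqr_ge0.
pose L j : K := ln j.+2%:R.
have L0 j : 0 < L j by rewrite ln_gt0// ltr1n.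
(* This [t] balances the two costs on a block of length [2 ^ j]: the quadratic terms, of order
   [t ^ 2 * 2 ^ j], become comparable to the level [L j]. *)
pose t j : K := Num.sqrt (L j / 2 ^+ j).
have p2 j : 0 < 2 ^+ j :> K by rewrite exprn_gt0.
have t0 j : 0 < t j by rewrite sqrtr_gt0 divr_gt0.
have t2 j : t j ^+ 2 * 2 ^+ j = L j.
  by rewrite sqr_sqrtr ?divfK ?gt_eqF// ltW// divr_gt0.
pose xi j z := t j * X z - t j ^+ 2 * X z ^+ 2 - t j ^+ 2 * s2.
have mxi j : measurable_fun setT (xi j).
  apply: measurable_funB => //; apply: measurable_funB; exact: measurable_funM.
have hxi j := exp_supermartingale_increment (t j) mX X0 X2.
pose F j := [set w | exists2 k, (k <= 2 ^ j)%N & L j *+ 2 <= psum Z (xi j) k w].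
have aeF : {ae P, forall w, \forall j \near \oo, ~ F j w}.
  apply: (@borel_cantelli_ae _ _ _ P F (fun j => expR (- (L j *+ 2))) 1).
    by move=> j; have := exp_maximal_inequality hZ (L j *+ 2) (2 ^ j) (mxi j) (hxi j).
  move=> n; under eq_bigr do rewrite expRN mulr2n expRD lnK ?posrE// -expr2.
  exact: sum_inv_sqr_le.
have aeQ := psum_linear_growth hZ mX2 (fun z => sqr_ge0 _) X2oo.
apply: filterS2 aeF aeQ => w [N _ hN] [B [N1 _ hN1]].
(* The summands come from the level [2 * L j], from the empirical quadratic term and from its
   compensator. The last factor is the square root of 4, lost in [L j <= 2 * ln (ln n)] and
   [2 ^ j <= 2 * n]. *)
exists ((2 + B + s2) * 2).
exists (maxn N1 (maxn ((2 ^ N).+2) (2 ^ 10))) => // n /=.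
rewrite !geq_max => /and3P[N1n Nn n10].
have n1 : (1 < n)%N by apply: leq_trans Nn.
set j := up_log 2 n.
have nj : (n <= 2 ^ j)%N by exact: up_logP.
have jn : (2 ^ j <= 2 * n)%N.
  have := up_log_gtn (leqnn 2) n1.
  have : (0 < j)%N by rewrite up_log_gt0.
  by rewrite -/j; case: j {nj} => // k _ /=; rewrite expnS leq_pmul2l// => /ltnW.
have Nj : (N <= j)%N.
  rewrite leqNgt; apply/negP => kN.
  have : (2 ^ j < 2 ^ N)%N by rewrite ltn_exp2l.
  move/(leq_ltn_trans (leq_trans Nn nj)).
  by rewrite ltnNge (leqW (leqnSn _)).
have j9 : (9 < j)%N by have := leq_trans n10 nj; rewrite leq_exp2l.
have LL := ln_dyadic_le j9 jn; rewrite -/(L j) in LL.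
have hQ := hN1 n N1n.
have Q0 : 0 <= psum Z (fun z => X z ^+ 2) n w by apply: sumr_ge0 => i _; exact: sqr_ge0.
have npos : 0 < n%:R :> K by rewrite ltr0n ltnW.
have B0 : 0 <= B by have := le_trans Q0 hQ; rewrite pmulr_lge0.
have hS : psum Z (xi j) n w < L j *+ 2.
  rewrite ltNge; apply/negP => h; apply: (hN j Nj); exists n => //.
have xiE : psum Z (xi j) n w = t j * psum Z X n w
    - t j ^+ 2 * psum Z (fun z => X z ^+ 2) n w - n%:R * (t j ^+ 2 * s2).
  rewrite /psum /xi !big_split/= !sumrN sumr_const card_ord -!mulr_sumr.
  by rewrite [n%:R * _]mulr_natl.
rewrite xiE in hS.
have n2j : n%:R <= 2 ^+ j :> K by rewrite -natrX ler_nat.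
have S1 : t j * psum Z X n w <= (2 + B + s2) * L j.
  have h1 : t j ^+ 2 * psum Z (fun z => X z ^+ 2) n w <= B * L j.
    rewrite -(t2 j) [leRHS]mulrCA ler_pM2l ?exprn_gt0//.
    by apply: le_trans hQ _; rewrite ler_wpM2l.
  have h2 : n%:R * (t j ^+ 2 * s2) <= s2 * L j.
    have ts : 0 <= t j ^+ 2 * s2 by rewrite mulr_ge0 ?sqr_ge0.
    rewrite -(t2 j) [leLHS]mulrC [leRHS]mulrCA [s2 * _]mulrC mulrA.
    by rewrite -[leRHS]mulrA [2 ^+ j * s2]mulrC mulrA ler_wpM2l.
  by move: hS; rewrite mulr2n; lra.
have S2 : psum Z X n w <= (2 + B + s2) * (t j * 2 ^+ j).
  rewrite -(ler_pM2l (t0 j)) (le_trans S1)// -(t2 j).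
  by rewrite le_eqVlt; apply/orP; left; apply/eqP; ring.
apply: (le_trans S2); rewrite -mulrA ler_wpM2l//; first by lra.
have lnln0 : 0 <= ln (ln n%:R) :> K by have := L0 j; rewrite mulr2n in LL; lra.
have tp0 : 0 <= t j * 2 ^+ j by rewrite mulr_ge0// ltW.
rewrite -[leLHS](ger0_norm tp0) -sqrtr_sqr.
have -> : 2 * Num.sqrt (n%:R * ln (ln n%:R)) = Num.sqrt (2 ^+ 2 * (n%:R * ln (ln n%:R))) :> K.
  by rewrite [RHS]sqrtrM ?sqr_ge0// sqrtr_sqr ger0_norm.
apply: ler_wsqrtr.
have -> : (t j * 2 ^+ j) ^+ 2 = L j * 2 ^+ j by rewrite -(t2 j); ring.
have j2n : 2 ^+ j <= 2 * n%:R :> K by rewrite -natrX -natrM ler_nat.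
apply: (@le_trans _ _ ((ln (ln n%:R) *+ 2) * (2 * n%:R))).
  by rewrite ler_pM// ltW.
by rewrite mulr2n; nra.
Qed.

End Iterated_logarithm.

Section Empirical_rate.
Context {d dT : measure_display} {Omega : measurableType d}
  {T : measurableType dT} {K : realType}.
Variables (P : probability Omega K) (rho : probability T K).
Variables (Z : nat -> {RV P >-> T}) (hZ : iid_from rho Z).
Variable (l : nat -> K).
Hypothesis l_pos : forall n, 0 < l n.
Hypothesis l_rate :
  l n * Num.sqrt (n%:R / ln (ln n%:R)) @[n --> \oo] --> +oo.

(** The iterated-logarithm bound is one-sided, hence applied to [f - m] and to its opposite. After
    division by [n * l n] it reads [B / v n], where [v] is the sequence that [l_rate] sends to
    infinity. *)
Lemma empirical_mean_rate (f : T -> K) (m : K) : measurable_fun setT f ->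
  (\int[rho]_z (f z ^+ 2)%:E < +oo)%E -> (\int[rho]_z (f z)%:E = m%:E)%E ->
  {ae P, forall w, `|n%:R^-1 * psum Z f n w - m| / l n @[n --> \oo] --> (0 : K)}.
Proof.
move=> mf f2 fm.
have mf2 : measurable_fun setT (fun z => f z ^+ 2) by exact: measurable_funX.
have if1 := sqr_integrable_integrable mf f2.
have ic : rho.-integrable setT (fun _ : T => m%:E).
  exact: finite_measure_integrable_cst.
pose X z := f z - m.
have mX : measurable_fun setT X by exact: measurable_funB.
have X0 : (\int[rho]_z (X z)%:E = 0)%E.
  under eq_integral do rewrite EFinB.
  rewrite integralB_EFin// fm integral_cst//= probability_setT mule1.
  by rewrite subee.
have X2 : (\int[rho]_z (X z ^+ 2)%:E < +oo)%E.
  apply: (@le_lt_trans _ _ (\int[rho]_z ((2 * f z ^+ 2)%:E + (2 * m ^+ 2)%:E))%E).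
    apply: ge0_le_integral => //.
    - by move=> z _; rewrite lee_fin sqr_ge0.
    - by apply/measurable_EFinP; exact: measurable_funX.
    - apply: emeasurable_funD => //; apply/measurable_EFinP.
      exact: measurable_funM.
    - move=> z _; rewrite -EFinD lee_fin /X.
      by have := sqr_ge0 (f z + m); rewrite !expr2; lra.
  have m2 : measurable_fun setT (fun z => (2 * f z ^+ 2)%:E).
    by apply/measurable_EFinP; exact: measurable_funM.
  have p2 z : (0 <= (2 * f z ^+ 2)%:E)%E by rewrite lee_fin mulr_ge0 ?sqr_ge0.
  rewrite ge0_integralD//; last by move=> z _; rewrite lee_fin mulr_ge0 ?sqr_ge0.
  under eq_integral do rewrite EFinM.
  rewrite ge0_integralZl_EFin//; last 2 first.
    by move=> z _; rewrite lee_fin sqr_ge0.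
    exact/measurable_EFinP.
  rewrite integral_cst//= probability_setT mule1 lte_add_pinfty ?ltry//.
  by rewrite lte_mul_pinfty.
pose Y z := - X z.
have mY : measurable_fun setT Y by exact: measurableT_comp.
have Y0 : (\int[rho]_z (Y z)%:E = 0)%E.
  have iX := sqr_integrable_integrable mX X2.
  under eq_integral do rewrite /Y -mulN1r EFinM.
  by rewrite (integralZl measurableT iX) X0 mule0.
have Y2 : (\int[rho]_z (Y z ^+ 2)%:E < +oo)%E.
  by under eq_integral do rewrite /Y sqrrN.
have aeX := psum_iterated_log_bound hZ mX X0 X2.
have aeY := psum_iterated_log_bound hZ mY Y0 Y2.
apply: filterS2 aeX aeY => w [B1 hB1] [B2 hB2].
pose B := `|B1| + `|B2|.
pose v n := l n * Num.sqrt (n%:R / ln (ln n%:R)).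
have vinv : (v n)^-1 @[n --> \oo] --> (0 : K).
  apply/gtr0_cvgV0; last exact: l_rate.
  by have /cvgryPgt := l_rate; apply.
have Bv : B * (v n)^-1 @[n --> \oo] --> (0 : K).
  by rewrite -[0](mulr0 B); exact: cvgMl_tmp.
apply: (squeeze_cvgr _ (cvg_cst 0) Bv).
have vpos : \forall n \near \oo, 0 < v n.
  by have /cvgryPgt h := l_rate; exact: (h 0).
have n2 : \forall n \near \oo, (0 < n)%N by exists 1%N.
apply: filterS3 (filterI hB1 hB2) vpos n2 => n [h1 h2] vn n0.
apply/andP; split; first by rewrite divr_ge0// ltW.
have n0' : 0 < n%:R :> K by rewrite ltr0n.
(* Positivity of [v n] excludes the default values of [sqrt], of [ln] and of division at small [n]:
   it forces [ln (ln n) > 0]. *)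
have sn : 0 < Num.sqrt (n%:R / ln (ln n%:R)) :> K.
  by rewrite -(pmulr_rgt0 _ (l_pos n)); exact: vn.
have lnln : 0 < ln (ln n%:R) :> K.
  by move: sn; rewrite sqrtr_gt0 pmulr_rgt0// invr_gt0.
set s := Num.sqrt (n%:R * ln (ln n%:R)) in h1 h2.
have sE : s = n%:R / Num.sqrt (n%:R / ln (ln n%:R)).
  rewrite /s; have -> : n%:R * ln (ln n%:R) = n%:R ^+ 2 / (n%:R / ln (ln n%:R)) :> K.
    by field; rewrite !gt_eqF.
  rewrite sqrtrM ?sqr_ge0// sqrtr_sqr gtr0_norm//; congr (_ * _).
  by rewrite sqrtrV// divr_ge0// ltW.
have s0 : 0 <= s by exact: sqrtr_ge0.
have pX : psum Z X n w = psum Z f n w - n%:R * m.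
  rewrite /psum /X big_split/= sumrN sumr_const card_ord; congr (_ - _).
  by rewrite mulr_natl.
have pY : psum Z Y n w = - psum Z X n w by rewrite /psum /Y sumrN.
have : `|psum Z X n w| <= B * s.
  rewrite ler_norml; apply/andP; split.
    rewrite lerNl -pY; apply: (le_trans h2); rewrite ler_wpM2r// /B.
    by rewrite (le_trans (ler_norm _))// lerDr.
  apply: (le_trans h1); rewrite ler_wpM2r// /B.
  by rewrite (le_trans (ler_norm _))// lerDl.
rewrite pX => h3.
have -> : n%:R^-1 * psum Z f n w - m = n%:R^-1 * (psum Z f n w - n%:R * m).
  by field; rewrite gt_eqF.
rewrite normrM gtr0_norm ?invr_gt0// ler_pdivrMr// /v.
rewrite ler_pdivrMl//; apply: (le_trans h3); rewrite sE.
rewrite le_eqVlt; apply/orP; left; apply/eqP; field.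
by rewrite !gt_eqF.
Qed.

End Empirical_rate.

(** * Linear algebra *)

Section Vectors.
Context {K : realType}.

Lemma coord_le_norm m n (x : 'M[K]_(m, n)) i j : `|x i j| <= `|x|.
Proof. by rewrite [leRHS]/Num.norm/= mx_normrE; exact: (le_bigmax _ _ (i, j)). Qed.

Lemma norm_le_coord m n (x : 'M[K]_(m, n)) c : 0 <= c ->
  (forall i j, `|x i j| <= c) -> `|x| <= c.
Proof.
move=> c0 xc; rewrite [leLHS]/Num.norm/= mx_normrE; apply/bigmax_leP; split => //.
Qed.

Lemma near_norm (V : normedModType K) (x : V) e (S : set V) :
  0 < e -> (forall y, `|x - y| < e -> S y) -> nbhs x S.
Proof. by move=> e0 h; apply/nbhs_normP; exists e. Qed.

Lemma dist_continuous (V : normedModType K) (x0 : V) :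
  continuous (fun x : V => `|x - x0|).
Proof.
move=> x; apply/(@cvgrPdist_lt _ _ _ (nbhs x)) => e e0; apply: (near_norm e0) => y xy.
apply: le_lt_trans xy; apply: le_trans (ler_dist_dist _ _) _.
by rewrite opprB addrA subrK.
Qed.

Lemma cV_bounded_closed_compact n (A : set 'cV[K]_n) c :
  (forall x, A x -> `|x| <= c) -> closed A -> compact A.
Proof.
move=> Ac clA.
have normT m1 n1 (x : 'M[K]_(m1, n1)) : `|x^T| <= `|x|.
  by apply: norm_le_coord => // i j; rewrite mxE; exact: coord_le_norm.
have contT m1 n1 : continuous (fun x : 'M[K]_(m1, n1) => x^T).
  move=> x; apply/(@cvgrPdist_lt _ _ _ (nbhs x)) => e e0; apply: (near_norm e0) => y.
  by rewrite -linearB/=; exact: le_lt_trans (normT _ _ _).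
rewrite (_ : A = (fun x : 'rV[K]_n => x^T) @` ((fun x : 'rV[K]_n => x^T) @^-1` A)).
  apply: continuous_compact; first by apply: continuous_subspaceT => x; exact: contT.
  apply: bounded_closed_compact; last by move/continuous_closedP: (@contT 1%N n); apply.
  exists c; split; first exact: num_real.
  move=> y cy x /Ac xc; apply: le_trans (ltW cy); apply: le_trans xc.
  by have := normT _ _ x^T; rewrite trmxK.
apply/seteqP; split => x; last by move=> [y Ay <-].
by move=> Ax; exists x^T; rewrite /= trmxK.
Qed.

Context {p : nat}.
Implicit Types (u v w : 'cV[K]_p) (A B C X Y : 'M[K]_p).

Lemma dotE u v : dot u v = (u^T *m v) 0 0.
Proof. by rewrite mxE; apply: eq_bigr => i _; rewrite mxE. Qed.

Lemma dotC u v : dot u v = dot v u.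
Proof. by apply: eq_bigr => i _; rewrite mulrC. Qed.

Lemma dotDr u v w : dot u (v + w) = dot u v + dot u w.
Proof. by rewrite !dotE mulmxDr mxE. Qed.

Lemma dotZr a u v : dot u (a *: v) = a * dot u v.
Proof. by rewrite !dotE -scalemxAr mxE. Qed.

Lemma dotNr u v : dot u (- v) = - dot u v.
Proof. by rewrite -scaleN1r dotZr mulN1r. Qed.

Lemma dotBr u v w : dot u (v - w) = dot u v - dot u w.
Proof. by rewrite dotDr dotNr. Qed.

Lemma dotDl u v w : dot (u + v) w = dot u w + dot v w.
Proof. by rewrite dotC dotDr !(dotC w). Qed.

Lemma dotZl a u v : dot (a *: u) v = a * dot u v.
Proof. by rewrite dotC dotZr dotC. Qed.

Lemma dotNl u v : dot (- u) v = - dot u v.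
Proof. by rewrite dotC dotNr dotC. Qed.

Lemma dotBl u v w : dot (u - v) w = dot u w - dot v w.
Proof. by rewrite dotDl dotNl. Qed.

Lemma dot0r u : dot u 0 = 0.
Proof. by rewrite dotE mulmx0 mxE. Qed.

Lemma dot0l u : dot 0 u = 0.
Proof. by rewrite dotC dot0r. Qed.

Lemma dot_mulmx A u v : dot (A *m u) v = dot u (A^T *m v).
Proof. by rewrite !dotE trmx_mul mulmxA. Qed.

Lemma dot_mulmx_sym A u v : A^T = A -> dot (A *m u) v = dot u (A *m v).
Proof. by rewrite dot_mulmx => ->. Qed.

Lemma dot_ge0 u : 0 <= dot u u.
Proof. by apply: sumr_ge0 => i _; rewrite -expr2 sqr_ge0. Qed.

Lemma norm_dot_le u v : `|dot u v| <= p%:R * `|u| * `|v|.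
Proof.
apply: le_trans (ler_norm_sum _ _ _) _.
rewrite -mulrA mulr_natl -[X in _ *+ X](card_ord p) -sumr_const.
by apply: ler_sum => i _; rewrite normrM ler_pM// coord_le_norm.
Qed.

Lemma dot_le u v : dot u v <= p%:R * `|u| * `|v|.
Proof. exact: le_trans (ler_norm _) (norm_dot_le _ _). Qed.

Lemma sqr_coord_le_dot u i : u i 0 ^+ 2 <= dot u u.
Proof.
rewrite /dot (bigD1 i)//= -expr2 lerDl; apply: sumr_ge0 => k _.
by rewrite -expr2 sqr_ge0.
Qed.

Lemma sqr_norm_le_dot u : `|u| ^+ 2 <= dot u u.
Proof.
have -> : dot u u = Num.sqrt (dot u u) ^+ 2 by rewrite sqr_sqrtr ?dot_ge0.
rewrite ler_sqr ?nnegrE ?sqrtr_ge0//.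
apply: norm_le_coord; first exact: sqrtr_ge0.
move=> i j; rewrite (ord1 j) -sqrtr_sqr; apply: ler_wsqrtr.
exact: sqr_coord_le_dot.
Qed.

Lemma dot_eq0 u : dot u u = 0 -> u = 0.
Proof.
move=> u0; apply/eqP; rewrite -normr_eq0 -sqrf_eq0 eq_le sqr_ge0 andbT.
by rewrite -u0 sqr_norm_le_dot.
Qed.

Lemma mulmx_norm_le A u : `|A *m u| <= p%:R * `|A| * `|u|.
Proof.
apply: norm_le_coord => [|i j]; first by rewrite !mulr_ge0.
rewrite mxE; apply: le_trans (ler_norm_sum _ _ _) _.
rewrite -mulrA mulr_natl -[X in _ *+ X](card_ord p) -sumr_const.
by apply: ler_sum => k _; rewrite normrM ler_pM// coord_le_norm.
Qed.

Lemma psd_cauchy_schwarz B u v : B^T = B -> (forall w, 0 <= dot (B *m w) w) ->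
  dot (B *m u) v ^+ 2 <= dot (B *m u) u * dot (B *m v) v.
Proof.
move=> Bs B0.
have quad t : 0 <= t ^+ 2 * dot (B *m u) u + 2 * t * dot (B *m u) v + dot (B *m v) v.
  have := B0 (t *: u + v); rewrite mulmxDr -scalemxAr !dotDl !dotDr !dotZl !dotZr.
  rewrite [dot (B *m v) u](dot_mulmx_sym _ _ Bs) (dotC v).
  by congr (_ <= _); ring.
move: quad (B0 u) (B0 v).
set a := dot (B *m u) u; set b := dot (B *m u) v; set c := dot (B *m v) v => quad a0 c0.
have [a_eq0|an0] := eqVneq a 0.
  rewrite a_eq0 mul0r; have [->|bn0] := eqVneq b 0; first by rewrite expr0n.
  (* Without quadratic term the polynomial is affine, and takes the value -1 at this point. *)
  have := quad (- (c + 1) / (2 * b)); rewrite a_eq0 mulr0 add0r.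
  have -> : 2 * (- (c + 1) / (2 * b)) * b = - (c + 1) by field.
  by lra.
have apos : 0 < a by rewrite lt_def an0.
have := quad (- b / a).
have -> : (- b / a) ^+ 2 * a + 2 * (- b / a) * b + c = (a * c - b ^+ 2) / a by field.
by rewrite pmulr_lge0 ?invr_gt0// subr_ge0.
Qed.

(** [A *m X] and [A *m Y] are symmetric and each fixes the range of [A]; transposing their product
    identifies them. The same holds for [X *m A] and [Y *m A]. *)
Lemma moore_penrose_unique A X Y :
  is_moore_penrose A X -> is_moore_penrose A Y -> X = Y.
Proof.
move=> [AXA XAX sAX sXA] [AYA YAY sAY sYA].
have eAX : A *m X = A *m Y.
  have h1 : (A *m Y) *m (A *m X) = A *m X by rewrite mulmxA AYA.
  have h2 : (A *m X) *m (A *m Y) = A *m Y by rewrite mulmxA AXA.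
  by rewrite -[LHS]h1 -[RHS]sAY -[in RHS]h2 trmx_mul sAX sAY.
have eXA : X *m A = Y *m A.
  have h1 : (X *m A) *m (Y *m A) = X *m A by rewrite -!mulmxA (mulmxA A) AYA.
  have h2 : (Y *m A) *m (X *m A) = Y *m A by rewrite -!mulmxA (mulmxA A) AXA.
  by rewrite -[LHS]h1 -[RHS]sYA -[in RHS]h2 trmx_mul sXA sYA.
by rewrite -XAX eXA -mulmxA eAX mulmxA.
Qed.

End Vectors.

Section Moore_Penrose.
Context {K : realType} {p : nat}.
Variables (C X : 'M[K]_p) (sC : C^T = C) (mp : is_moore_penrose C X).
Hypothesis C0 : forall w, 0 <= dot (C *m w) w.

(** The orthogonal projector onto [Im C]. Membership in [Im C] is handled below as being fixed by
    [Q]. *)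
Local Notation Q := (C *m X).

(** The transpose of [X] is a pseudo-inverse of the transpose of [C], which is [C]; uniqueness
    concludes. *)
Lemma mp_sym : X^T = X.
Proof.
have [CXC XCX sCX sXC] := mp; apply: (moore_penrose_unique _ mp).
have tCX : C *m X^T = X *m C by rewrite -sXC trmx_mul sC.
have tXC : X^T *m C = C *m X by rewrite -sCX trmx_mul sC.
split.
- by rewrite -[RHS]sC -[in RHS]CXC !trmx_mul sC mulmxA.
- by rewrite -[in RHS]XCX !trmx_mul sC mulmxA.
- by rewrite tCX.
- by rewrite tXC.
Qed.

Lemma mp_comm : X *m C = Q.
Proof. by have [_ _ <- _] := mp; rewrite trmx_mul sC mp_sym. Qed.

Lemma mp_image (v : 'cV[K]_p) : Q *m (C *m v) = C *m v.
Proof. by have [CXC _ _ _] := mp; rewrite mulmxA CXC. Qed.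

Lemma mp_dualK (v : 'cV[K]_p) : X *m (Q *m v) = X *m v.
Proof. by have [_ XCX _ _] := mp; rewrite !mulmxA XCX. Qed.

Lemma mp_proj_idem (v : 'cV[K]_p) : Q *m (Q *m v) = Q *m v.
Proof. by rewrite -[Q *m v]mulmxA mp_image. Qed.

Lemma mp_mulmx_proj (v : 'cV[K]_p) : C *m (Q *m v) = C *m v.
Proof. by have [CXC _ _ _] := mp; rewrite -mp_comm !mulmxA CXC. Qed.

Lemma dot_projl (u v : 'cV[K]_p) : dot (Q *m u) v = dot u (Q *m v).
Proof. by have [_ _ sCX _] := mp; rewrite dot_mulmx sCX. Qed.

(** Definiteness of [C] on its image, without eigenvalues. Cauchy-Schwarz for the form [C] between
    [X *m v] and [v] bounds the fourth power of the norm of [Q *m v] by the product of the form at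
    [v] and of the form [X] at [Q *m v]; the latter is at most a constant times the squared norm of
    [Q *m v]. *)
Lemma psd_coercive : exists2 kappa : K, 0 < kappa &
  forall v : 'cV[K]_p, kappa * `|Q *m v| ^+ 2 <= dot (C *m v) v.
Proof.
exists (p%:R * (p%:R * `|X|) + 1)^-1 => [|v].
  by rewrite invr_gt0 ltr_wpDl// !mulr_ge0.
set a := p%:R * (p%:R * `|X|); have a0 : 0 <= a by rewrite !mulr_ge0.
rewrite ler_pdivrMl; last by lra.
have [->|qn0] := eqVneq (Q *m v) 0.
  by rewrite normr0 expr0n mulr_ge0// addr_ge0.
set q := `|Q *m v|; have q0 : 0 < q by rewrite normr_gt0.
have h1 := psd_cauchy_schwarz (X *m v) v sC C0.
have e1 : dot (C *m (X *m v)) v = dot (Q *m v) (Q *m v).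
  by rewrite mulmxA -{1}mp_proj_idem dot_projl.
have e2 : dot (C *m (X *m v)) (X *m v) = dot (Q *m v) (X *m (Q *m v)).
  by rewrite mp_dualK mulmxA.
rewrite e1 e2 in h1.
have h2 := sqr_norm_le_dot (Q *m v); rewrite -/q in h2.
have h3 : dot (Q *m v) (X *m (Q *m v)) <= a * q ^+ 2.
  apply: le_trans (dot_le _ _) _; rewrite -/q.
  apply: (@le_trans _ _ (p%:R * q * (p%:R * `|X| * q))).
    by rewrite ler_wpM2l ?mulmx_norm_le// mulr_ge0// ltW.
  by rewrite le_eqVlt /a; apply/orP; left; apply/eqP; ring.
have h4 : q ^+ 2 * q ^+ 2 <= a * q ^+ 2 * dot (C *m v) v.
  apply: (@le_trans _ _ (dot (Q *m v) (Q *m v) ^+ 2)).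
    by rewrite [leRHS]expr2 ler_pM ?sqr_ge0.
  by apply: le_trans h1 _; rewrite ler_wpM2r.
have h5 : q ^+ 2 <= a * dot (C *m v) v.
  by rewrite -(ler_pM2r (exprn_gt0 2 q0)) (le_trans h4)// mulrAC.
by apply: le_trans h5 _; rewrite mulrDl lerDl mul1r.
Qed.

Lemma mp_psd v : 0 <= dot (X *m v) v.
Proof.
have [_ XCX _ _] := mp.
by rewrite -{1}XCX -2!mulmxA dot_mulmx mp_sym; exact: C0.
Qed.

(** Definiteness of the dual objective on [Im C]; this is what distinguishes [eta0] from every other
    feasible dual vector. *)
Lemma mp_pd v : Q *m v = v -> dot (X *m v) v = 0 -> v = 0.
Proof.
move=> Qv v0; have [kappa k0 coerc] := psd_coercive.
have : Q *m (X *m v) = 0.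
  apply/eqP; rewrite -normr_eq0 -sqrf_eq0 eq_le sqr_ge0 andbT.
  rewrite -(pmulr_rle0 _ k0); apply: le_trans (coerc _) _.
  by rewrite mulmxA Qv dotC v0.
by move/(congr1 (mulmx C)); rewrite mp_mulmx_proj mulmxA Qv mulmx0.
Qed.

End Moore_Penrose.

(** * Convexity and strata *)

Section Relative_interior.
Context {K : realType} {p : nat}.
Local Notation V := 'cV[K]_p.

Definition convex_subset (S : set V) := forall x y (t : K),
  S x -> S y -> 0 <= t <= 1 -> S (t *: x + (1 - t) *: y).

(** Points of the simplex with vertices [s0] and [s i], off the face opposite to [s0]: the strict
    inequality keeps the weight [1 - a] invertible in the induction. *)
Lemma convex_subset_sum (S : set V) n (c : 'I_n -> K) (s : 'I_n -> V) s0 :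
  convex_subset S -> S s0 -> (forall i, S (s i)) -> (forall i, 0 <= c i) ->
  \sum_i c i < 1 -> S (s0 + \sum_i c i *: (s i - s0)).
Proof.
move=> cS Ss0; elim: n c s => [|n IH] c s Ss c0 c1; first by rewrite big_ord0 addr0.
pose w i : 'I_n.+1 := widen_ord (leqnSn n) i.
rewrite big_ord_recr/= in c1; rewrite big_ord_recr/= -/(w _).
set a := c ord_max in c1 *.
have sum0 : 0 <= \sum_(i < n) c (w i) by apply: sumr_ge0 => i _; exact: c0.
have a0 : 0 <= a by exact: c0.
have a1 : 0 < 1 - a by move: c1 sum0; rewrite /w; lra.
have h : S (s0 + \sum_i ((1 - a)^-1 * c (w i)) *: (s (w i) - s0)).
  apply: IH => //.
  - by move=> i; rewrite mulr_ge0 ?invr_ge0 ?c0// ltW.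
  - by rewrite -mulr_sumr ltr_pdivrMl// mulr1 ltrBrDr; exact: c1.
 have := cS _ _ a (Ss ord_max) h; rewrite a0 /= -[a <= 1]subr_ge0 ltW//.
move=> /(_ isT); congr S.
have -> : (1 - a) *: (s0 + \sum_i ((1 - a)^-1 * c (w i)) *: (s (w i) - s0)) =
    (s0 - a *: s0) + \sum_i c (w i) *: (s (w i) - s0).
  rewrite scalerDr scalerBl scale1r; congr (_ + _); rewrite scaler_sumr.
  by apply: eq_bigr => i _; rewrite scalerA mulrA divff ?gt_eqF// mul1r.
by rewrite scalerBr addrCA -!addrA; congr (_ + _); rewrite addrC -addrA addrCA.
Qed.

(** A maximal free family of differences [s i - x] spans all differences from [x] within the affine
    hull. Barycentric coordinates are continuous there, so [S] contains a relative neighbourhood of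
    the barycentre [b]. Homotheties centred at [x] carry it arbitrarily close to [x] while staying
    in [S]. *)
Lemma convex_relint_dense (S : set V) : convex_subset S ->
  S `<=` closure (relint S).
Proof.
move=> cS x Sx.
pose A k (s : 'I_k -> V) : 'M[K]_(k, p) := \matrix_(i < k) (s i - x)^T.
pose good k := exists s : 'I_k -> V, (forall i, S (s i)) /\ row_free (A k s).
have good0 : exists k, `[< good k >].
  exists 0%N; apply/asboolP; exists (fun=> x); split; first by case.
  by rewrite /row_free; apply/eqP; apply/eqP; rewrite -leqn0 rank_leq_row.
have good_le k : `[< good k >] -> (k <= p)%N.
  by move=> /asboolP[s [_ /eqP <-]]; exact: rank_leq_col.
case: (ex_maxnP good0 good_le) => k /asboolP[s [Ss freeA]] maxk.
set B := A k s in freeA.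
have spanS y : S y -> ((y - x)^T <= B)%MS.
  move=> Sy; apply: contrapT => /negP nsub.
  have : `[< good (k + 1)%N >].
    apply/asboolP; exists (fun i : 'I_(k + 1) => match fintype.split i with inl j => s j | inr _ => y end).
    split; first by move=> i; case: fintype.split.
    apply: inj_row_free => v.
    have -> : A (k + 1)%N (fun i : 'I_(k + 1) => match fintype.split i with inl j => s j | inr _ => y end) =
        col_mx B (y - x)^T.
      apply/matrixP => i j; rewrite !mxE; by case: fintype.split => a; rewrite !mxE// (ord1 a).
    rewrite -[v]hsubmxK mul_row_col => v0.
    have [v20|v2n0] := eqVneq (rsubmx v) 0.
      have : lsubmx v *m B = 0 by move: v0; rewrite v20 mul0mx addr0.
      move/eqP; rewrite mulmx_free_eq0// => /eqP ->.
      by rewrite v20 row_mx0.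
    exfalso; move: nsub => /negP; apply.
    have vne : rsubmx v 0 0 != 0.
      apply: contraNneq v2n0 => h; apply/eqP/matrixP => i j.
      by rewrite (ord1 i) (ord1 j) h mxE.
    apply/submxP; exists (- (rsubmx v 0 0)^-1 *: lsubmx v).
    move/eqP: v0; rewrite addr_eq0 => /eqP v0.
    have rE : rsubmx v *m (y - x)^T = rsubmx v 0 0 *: (y - x)^T.
      by rewrite {1}[rsubmx v]mx11_scalar mul_scalar_mx.
    rewrite -scalemxAl v0 rE scalerN scaleNr opprK.
    by rewrite scalerA mulVf// scale1r.
  by move/maxk; rewrite addn1 ltnn.
have spanA y : affine_hull S y -> ((y - x)^T <= B)%MS.
  move=> [n [a [z [Sz a1 ->]]]].
  have -> : \sum_i a i *: z i - x = \sum_i a i *: (z i - x).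
    under [RHS]eq_bigr do rewrite scalerBr.
    by rewrite big_split/= sumrN -scaler_suml a1 scale1r.
  rewrite linear_sum/=; apply: summx_sub => i _.
  by rewrite linearZ/=; apply: scalemx_sub; exact: spanS.
pose c (y : V) : 'rV[K]_k := (y - x)^T *m pinvmx B.
have yE y : ((y - x)^T <= B)%MS -> y = x + \sum_i c y 0 i *: (s i - x).
  move=> /mulmxKpV h; rewrite -[y in LHS](subrK x) addrC; congr (_ + _).
  rewrite -[LHS]trmxK -h mulmx_sum_row linear_sum/=.
  by apply: eq_bigr => i _; rewrite linearZ/= rowK trmxK.
pose k1 : K := (k.+1%:R)^-1.
have k10 : 0 < k1 by rewrite invr_gt0.
have k1E : 1 - k%:R * k1 = k1.
  by rewrite /k1 -natr1; field; rewrite natr1 pnatr_eq0.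
pose b : V := x + \sum_i k1 *: (s i - x).
have subb : ((b - x)^T <= B)%MS.
  rewrite /b addrAC subrr add0r linear_sum; apply: summx_sub => i _.
  by rewrite linearZ/=; apply: scalemx_sub; exact: spanS.
have cb i : c b 0 i = k1.
  have : (b - x)^T = (const_mx k1 : 'rV[K]_k) *m B.
    rewrite /b addrAC subrr add0r linear_sum mulmx_sum_row.
    by apply: eq_bigr => j _; rewrite linearZ/= rowK mxE.
  by rewrite /c => ->; rewrite mulmxKp// mxE.
have [e e0 he] : exists2 e : K, 0 < e & forall y, ((y - x)^T <= B)%MS ->
    `|y - b| < e -> S y.
  pose m := p%:R * `|pinvmx B| + 1.
  have m0 : 0 < m by rewrite ltr_wpDl// mulr_ge0.
  (* Coordinates of [b] all equal [k1 = 1 / (k + 1)]. Moving each by less than [k1 ^ 2] keeps them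
     nonnegative, and their sum below [k * (k1 + k1 ^ 2) = 1 - k1 ^ 2]. *)
  exists (k1 ^+ 2 / m) => [|y suby yb]; first by rewrite divr_gt0// exprn_gt0.
  have cy i : `|c y 0 i - k1| < k1 ^+ 2.
    have -> : c y 0 i - k1 = dot (y - b) (col i (pinvmx B)).
      rewrite -(cb i) /c.
      have -> : (y - x)^T = (y - b)^T + (b - x)^T by rewrite -linearD/= addrA subrK.
      set g := (y - b)^T; set f := (b - x)^T.
      have -> : ((g + f) *m pinvmx B) 0 i - (f *m pinvmx B) 0 i = (g *m pinvmx B) 0 i.
        by rewrite mulmxDl mxE addrK.
      rewrite dotE !mxE.
      by apply: eq_bigr => j _; rewrite !mxE.
    apply: le_lt_trans (norm_dot_le _ _) _.
    apply: (@le_lt_trans _ _ (`|y - b| * m)).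
      rewrite [p%:R * _]mulrC -mulrA ler_wpM2l// /m.
      have : `|col i (pinvmx B)| <= `|pinvmx B|.
        by apply: norm_le_coord => // j l; rewrite mxE coord_le_norm.
      move=> /(ler_wpM2l (ler0n K p)); lra.
    by rewrite -ltr_pdivlMr.
  rewrite (yE _ suby); apply: convex_subset_sum => //.
  - move=> i; have := cy i; rewrite ltr_norml => /andP[+ _].
    have : k1 <= 1 by rewrite invf_le1// ler1n.
    by rewrite expr2; nra.
  - apply: (@le_lt_trans _ _ (\sum_(i < k) (k1 + k1 ^+ 2))).
      apply: ler_sum => i _; have := cy i; rewrite ltr_norml => /andP[_].
      by lra.
    rewrite sumr_const card_ord -mulr_natl mulrDr expr2 mulrA.
    by have : k%:R * k1 < 1 by [lra]; nra.
move=> N /(@nbhs_ballP K V) [r /= r0 rN].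
(* As the rows are free, equality means an empty family, that is, [S] reduced to [x]. *)
have [/eqP bx|bx] := boolP (b - x == 0).
  exists x; split; last by apply: rN; exact: ballxx.
  split => //; apply: (near_norm e0) => y xy /spanA suby.
  by apply: he => //; rewrite (_ : b = x) 1?distrC//; apply/eqP; rewrite -subr_eq0 bx.
have bx0 : 0 < `|b - x| by rewrite normr_gt0.
pose t := Num.min 1 (r / (2 * `|b - x|)).
have t0 : 0 < t by rewrite lt_min ltr01/= divr_gt0// mulr_gt0.
have t1 : t <= 1 by rewrite ge_min lexx.
have convt z : S z -> S (t *: z + (1 - t) *: x).
  by move=> Sz; apply: cS => //; rewrite ltW.
(* The image of [b] under the homothety of centre [x] and ratio [t]; the relative ball of radius [e]
   shrinks to radius [t * e]. *)
pose y0 := t *: b + (1 - t) *: x.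
have y0x : y0 - x = t *: (b - x).
  by rewrite /y0 scalerBl scale1r addrA addrAC addrK scalerBr.
have Sb : S b by apply: he => //; rewrite subrr normr0.
exists y0; split; last first.
  apply: rN; rewrite -ball_normE/= distrC y0x normrZ gtr0_norm//.
  apply: (@le_lt_trans _ _ (r / 2)); last lra.
  rewrite -ler_pdivlMr// -mulrA -invfM ge_min.
  by apply/orP; right.
split; first exact: convt.
have te0 : 0 < t * e by rewrite mulr_gt0.
apply: (near_norm te0) => y y0y /spanA suby.
pose z := b + t^-1 *: (y - y0).
have -> : y = t *: z + (1 - t) *: x.
  rewrite /z scalerDr scalerA divff ?gt_eqF// scale1r addrAC -/y0.
  by rewrite addrC subrK.
apply: convt; apply: he.
  rewrite /z addrAC linearD/= addmx_sub// linearZ/=; apply: scalemx_sub.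
  have -> : y - y0 = (y - x) - (y0 - x) by rewrite opprB addrA subrK.
  rewrite y0x linearB/= addmx_sub// -linearN/= -scalerN linearZ/=.
  by apply: scalemx_sub; rewrite linearN/= eqmx_opp.
rewrite /z addrAC subrr add0r normrZ gtr0_norm ?invr_gt0//.
by rewrite ltr_pdivrMl// distrC.
Qed.

End Relative_interior.

Section Strata.
Context {K : realType} {p : nat}.
Local Notation V := 'cV[K]_p.

Lemma stratum_ofP (M : set (set V)) D w : partition M id D -> D w ->
  M (stratum_of M w) /\ stratum_of M w w.
Proof.
move=> [<- _ _] [S MS Sw]; rewrite /stratum_of /pblock.
by have [] := getPex (ex_intro (fun S => M S /\ id S w) S (conj MS Sw)).
Qed.

(** The closures that miss [x] have a closed union, by finiteness. The map [f] is the identity for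
    primal strata and [J_op R] for dual ones. *)
Lemma near_finite_closure (T : topologicalType) (F : set (set T))
    (f : set T -> set T) x : finite_set F ->
  \forall y \near x, forall S, F S -> closure (f S) y -> closure (f S) x.
Proof.
move=> finF; pose G := F `&` [set S | ~ closure (f S) x].
have clG : closed (\bigcup_(S in G) closure (f S)).
  apply: closed_bigcup; first by apply: sub_finite_set finF => S [].
  by move=> S _; exact: closed_closure.
have nG : (~` (\bigcup_(S in G) closure (f S))) x by move=> [S [_ nx]] /nx.
apply: filterS (open_nbhs_nbhs (conj (closed_openC clG) nG)) => y ny S FS yS.
by apply: contrapT => nx; apply: ny; exists S.
Qed.

Lemma subdiff_convex (R : V -> \bar K) w : convex_subset (subdiff R w).
Proof.
move=> x y t hx hy /andP[t0 t1] v; move: (hx v) (hy v).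
case: (R w) => [r| |]; case: (R v) => [s| |] //; last first.
  by move=> _ _; exact: leey.
rewrite -!EFinD !lee_fin dotDl !dotZl => h1 h2.
have h1' := ler_wpM2l t0 h1.
have t1' : 0 <= 1 - t by rewrite subr_ge0.
have h2' := ler_wpM2l t1' h2.
by move: h1' h2'; lra.
Qed.

(** Equality in Fenchel-Young at [(w, eta)] makes [w] a subgradient of the conjugate at [eta]. It
    places [eta0] in a dual stratum. *)
Lemma subdiff_dom_conjugate (R : V -> \bar K) w eta : proper_function R ->
  subdiff R w eta -> dom_subdiff (conjugate R) eta.
Proof.
move=> [RNy [v0 Rv0]] hw.
have Rw : R w \is a fin_num.
  rewrite fin_numE RNy/=; apply/eqP => Rwy; have := hw v0.
  by rewrite Rwy addye// leye_eq (negbTE Rv0).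
have e1 : (conjugate R eta = (dot eta w)%:E - R w)%E.
  apply/eqP; rewrite eq_le; apply/andP; split.
    apply: ge_ereal_sup => _ [v _ <-]; have := hw v.
    rewrite -(fineK Rw); have := RNy v; case: (R v) => [s| |] //= _; last first.
      by move=> _; exact: leNye.
    by rewrite -EFinD -!EFinB !lee_fin dotBr; lra.
  by apply/ereal_sup_ubound; exists w.
exists w => xi; rewrite e1.
apply: (@le_trans _ _ ((dot xi w)%:E - R w)%E); last by rewrite /conjugate; apply/ereal_sup_ubound; exists w.
rewrite -(fineK Rw) -!EFinB -EFinD lee_fin dotBr.
by rewrite (dotC eta) (dotC xi); lra.
Qed.

(** Near [w0] only strata with [w0] in their closure are met. On the dual side [eta] lies in the
    closure of [J_op R] of the stratum of [w], by density of the relative interior; hence so does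
    [eta0] when [eta] is close to it. This compares dual strata, and [J_op R] reverses the
    comparison. *)
Lemma mirror_strat_local (R : V -> \bar K) M Ms w0 eta0 :
  proper_function R -> mirror_stratifiable R M Ms -> subdiff R w0 eta0 ->
  exists2 U, nbhs w0 U & exists2 U', nbhs eta0 U' & forall w eta,
    U w -> U' eta -> subdiff R w eta ->
    strat_le (stratum_of M w0) (stratum_of M w) /\
    strat_le (stratum_of M w) (J_op (conjugate R) (stratum_of Ms eta0)).
Proof.
move=> pR [[finM partM closM] [finMs partMs closMs] JM JMs Jdec] h0.
have D0 : dom_subdiff R w0 by exists eta0.
have Ds0 := subdiff_dom_conjugate pR h0.
have [Mw0 w0in] := stratum_ofP partM D0.
have [Me0 e0in] := stratum_ofP partMs Ds0.
exists [set w | forall S, M S -> closure S w -> closure S w0].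
  exact: (@near_finite_closure _ M id w0 finM).
exists [set eta | forall S, M S -> closure (J_op R S) eta -> closure (J_op R S) eta0].
  exact: (@near_finite_closure _ M (J_op R) eta0 finM).
move=> w eta /= hw heta hsub.
have Dw : dom_subdiff R w by exists eta.
have [Mw win] := stratum_ofP partM Dw; split.
  apply: closM => //; exists w0; split => //; apply: hw => //.
  exact: subset_closure.
have [MsJ JJ] := JM _ Mw; have [MJ JJs] := JMs _ Me0.
apply/Jdec => //; rewrite JJs; apply: closMs => //; exists eta0; split => //.
apply: heta => //; have := convex_relint_dense (subdiff_convex (R := R) (w := w)) hsub.
by apply: closureS => xi xin; exists w.
Qed.

End Strata.

(** * Convergence of the primal and dual solutions *)

Section Convergence.
Context {K : realType} {p : nat}.
Local Notation V := 'cV[K]_p.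
Variables (R : V -> \bar K) (C X : 'M[K]_p) (w0 eta0 : V).
Hypothesis hproper : proper_function R.
Hypothesis hlsc : lower_semicontinuous R.
Hypothesis hconvex : econvex R.
Hypothesis (sC : C^T = C) (C0 : forall w, 0 <= dot (C *m w) w).
Hypothesis mp : is_moore_penrose C X.
Hypothesis uniq_w0 : forall w, C *m (w - w0) = 0 -> (R w <= R w0)%E -> w = w0.
Hypothesis heta0 : argmin (dual_objective X)
  (subdiff R w0 `&` matrix_image C) eta0.
Local Notation Q := (C *m X).

Definition quad (A : 'M[K]_p) (g h : V) : K := 2^-1 * dot (A *m h) h + dot g h.

(* The empirical objective up to the additive constant [n^-1 sum_i res_i^2 / 2]. *)
Definition shifted_objective (l : K) (A : 'M[K]_p) (g w : V) : \bar K :=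
  (l%:E * R w + (quad A g (w - w0))%:E)%E.

Let fin_R w eta : subdiff R w eta -> R w \is a fin_num.
Proof.
have [RNy [v0 Rv0]] := hproper => hw.
rewrite fin_numE RNy/=; apply/eqP => Rwy; have := hw v0.
by rewrite Rwy addye// leye_eq (negbTE Rv0).
Qed.

Let subdiff_w0 : subdiff R w0 eta0. Proof. by have [[]] := heta0. Qed.

Let r0 := fine (R w0).

Let r0E : R w0 = r0%:E. Proof. by rewrite /r0 fineK// (fin_R subdiff_w0). Qed.

Let Qeta0 : Q *m eta0 = eta0.
Proof. by have [[_ [v _ <-]] _] := heta0; rewrite (mp_image mp). Qed.

Lemma argmin_shifted_fin l A g w : 0 < l ->
  argmin (shifted_objective l A g) [set: V] w -> R w = (fine (R w))%:E.
Proof.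
move=> l0 [_ /(_ w0 I)]; rewrite /shifted_objective r0E -EFinM -EFinD.
have := hproper.1 w; case: (R w) => [r| |]//= _.
by rewrite gt0_muley ?lte_fin//.
Qed.

Lemma argmin_shifted_le l A g w v s : 0 < l ->
  argmin (shifted_objective l A g) [set: V] w -> (R v <= s%:E)%E ->
  l * fine (R w) + quad A g (w - w0) <= l * s + quad A g (v - w0).
Proof.
move=> l0 hw Rv; have [_ /(_ v I)] := hw.
rewrite /shifted_objective (argmin_shifted_fin l0 hw)/=.
have := hproper.1 v; move: Rv; case: (R v) => [t| |]//.
rewrite -!EFinM -!EFinD !lee_fin => ts _ h; apply: le_trans h _.
by rewrite lerD2r ler_pM2l.
Qed.

(** Minus the gradient of the quadratic part, divided by [l]. With [g = Cn w0 - un] and [A = Cn]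
    this is the certificate [eta_n]. *)
Definition etahat (l : K) (A : 'M[K]_p) (g w : V) : V :=
  - (l^-1 *: (g + A *m (w - w0))).

(** First-order optimality by hand: [w] is compared with points of the segment towards [v], where
    convexity bounds [R] and the quadratic part contributes its derivative up to order [t ^ 2]. *)
Lemma etahat_subdiff l A g w : 0 < l -> A^T = A ->
  argmin (shifted_objective l A g) [set: V] w -> subdiff R w (etahat l A g w).
Proof.
move=> l0 sA hw v; have Rw := argmin_shifted_fin l0 hw.
have := hproper.1 v; case Rv : (R v) => [s| |]// _; last exact: leey.
rewrite Rw -EFinD lee_fin; set r := fine (R w) in Rw *.
set h := w - w0; set d := v - w.
suff : 0 <= l * (s - r) + dot (g + A *m h) d.
  rewrite /etahat dotNl dotZl -/h => H.
  rewrite -(ler_pM2l l0) mulrDr mulrN mulrA divff ?gt_eqF// mul1r.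
  by move: H; lra.
set L := l * (s - r) + _; set a := dot (A *m d) d.
have key t : 0 < t -> t <= 1 -> 0 <= L + t * (2^-1 * a).
  move=> t0 t1.
  have Rt : (R (t *: v + (1 - t) *: w) <= (t * s + (1 - t) * r)%:E)%E.
    apply: le_trans (hconvex _ _ _) _; first by rewrite ltW.
    by rewrite Rv Rw -!EFinM -EFinD.
  have := argmin_shifted_le l0 hw Rt.
  have -> : t *: v + (1 - t) *: w - w0 = h + t *: d.
    by apply/matrixP => i j; rewrite !mxE; ring.
  rewrite -/h -/r /quad (mulmxDr A h) -scalemxAr.
  rewrite !(dotDl (A *m h)) !(dotDr _ h) !dotZl !dotZr -/a.
  have -> : dot (A *m d) h = dot (A *m h) d by rewrite (dot_mulmx_sym _ _ sA) dotC.
  rewrite /L dotDl => H.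
  by rewrite -(pmulr_rge0 _ t0); move: H; lra.
rewrite leNgt; apply/negP => L0.
have a1 : 0 < `|a| + 1 by rewrite ltr_wpDl.
(* So small that [t * a / 2] cannot compensate the supposedly negative [L]. *)
pose t := Num.min 1 (- L / (`|a| + 1)).
have t0 : 0 < t by rewrite lt_min ltr01/= divr_gt0// oppr_gt0.
have t1 : t <= 1 by rewrite ge_min lexx.
have t2 : t * (`|a| + 1) <= - L by rewrite -ler_pdivlMr// ge_min lexx orbT.
have := key t t0 t1.
have : t * a <= t * `|a| by rewrite ler_pM2l// ler_norm.
by lra.
Qed.

Lemma etahat_image l A g w : Q *m A = A -> Q *m g = g ->
  Q *m etahat l A g w = etahat l A g w.
Proof.
move=> QA Qg; rewrite /etahat mulmxN -scalemxAr mulmxDr Qg.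
by rewrite (mulmxA Q A (w - w0)) QA.
Qed.

Section Estimates.
Variables (kappa l : K) (A : 'M[K]_p) (g w : V).
Hypothesis kappa0 : 0 < kappa.
Hypothesis coercive : forall v : V, kappa * `|Q *m v| ^+ 2 <= dot (C *m v) v.
Hypotheses (l0 : 0 < l) (sA : A^T = A) (QA : Q *m A = A) (Qg : Q *m g = g).
Hypotheses (gl : `|g| <= l) (AC : p%:R * (p%:R * `|A - C|) <= kappa / 2).
Hypothesis hw : argmin (shifted_objective l A g) [set: V] w.
Let h := w - w0.

Let AQ (v : V) : A *m (Q *m v) = A *m v.
Proof.
have [_ _ sQ _] := mp; rewrite mulmxA; congr (_ *m v).
by rewrite -[in LHS]sA -sQ -trmx_mul QA.
Qed.

(** [A] acts within [Im C] just as [C] does, so the perturbation is measured against the projected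
    vector alone and costs at most half of [kappa]. *)
Lemma perturbed_coercive (v : V) : kappa / 2 * `|Q *m v| ^+ 2 <= dot (A *m v) v.
Proof.
have -> : dot (A *m v) v = dot (C *m (Q *m v)) (Q *m v) + dot ((A - C) *m (Q *m v)) (Q *m v).
  rewrite -dotDl -mulmxDl addrC subrK AQ -(dot_projl mp).
  by rewrite [Q *m _]mulmxA QA.
have h1 := coercive (Q *m v); rewrite (mp_proj_idem mp) in h1.
set q := `|Q *m v| in h1 *.
have h2 : `|dot ((A - C) *m (Q *m v)) (Q *m v)| <= kappa / 2 * q ^+ 2.
  apply: le_trans (norm_dot_le _ _) _.
  apply: (@le_trans _ _ (p%:R * (p%:R * `|A - C| * q) * q)).
    by rewrite ler_wpM2r// ler_wpM2l// mulmx_norm_le.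
  by have := ler_wpM2r (sqr_ge0 q) AC; rewrite expr2; lra.
by move: h2; rewrite ler_norml => /andP[h2 _]; lra.
Qed.

(** The factor in [q <= error_const * l] read off from [kappa / 4 * q ^ 2 <= p * (|eta0| + 1) * l *
    q], where [q] is the norm of the projected error. *)
Definition error_const := 4 * p%:R / kappa * (`|eta0| + 1).

Lemma optimality_gap :
  l * (fine (R w) - r0) + 2^-1 * dot (A *m h) h + dot g (Q *m h) <= 0.
Proof.
have := argmin_shifted_le l0 hw (eq_ind_r (fun z => (z <= r0%:E)%E) (lexx _) r0E).
rewrite subrr /quad mulmx0 !dot0r mulr0 addr0 -/h -(dot_projl mp) Qg.
by lra.
Qed.

(** The subgradient [eta0], being in [Im C], bounds [R w - R w0] below by a multiple of the
    projected error. All linear terms then carry a factor [l], against a quadratic term that does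
    not. *)
Lemma projected_error_le : `|Q *m h| <= error_const * l.
Proof.
set q := `|Q *m h|.
have h1 := optimality_gap; have h2 := perturbed_coercive h; rewrite -/q in h2.
have h3 : dot eta0 (Q *m h) <= fine (R w) - r0.
  have := subdiff_w0 w; rewrite r0E (argmin_shifted_fin l0 hw) -EFinD lee_fin.
  by rewrite -/h -{1}Qeta0 (dot_projl mp); lra.
have h4 : - (p%:R * `|eta0| * q) <= dot eta0 (Q *m h).
  by have := norm_dot_le eta0 (Q *m h); rewrite ler_norml => /andP[].
have h5 : - (p%:R * `|g| * q) <= dot g (Q *m h).
  by have := norm_dot_le g (Q *m h); rewrite ler_norml => /andP[].
have h6 : p%:R * `|g| * q <= p%:R * l * q.
  exact: (ler_wpM2r (normr_ge0 _) (ler_wpM2l (ler0n _ _) gl)).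
have h7 : l * - (p%:R * `|eta0| * q) <= l * (fine (R w) - r0).
  by rewrite ler_pM2l// (le_trans h4).
have h8 : kappa / 4 * q * q <= p%:R * (`|eta0| + 1) * l * q.
  by move: h1 h2 h5 h6 h7; rewrite expr2; lra.
have [q0|qn0] := eqVneq q 0.
  by rewrite q0 !mulr_ge0// ?addr_ge0// ?invr_ge0 ltW.
have qpos : 0 < q by rewrite lt_def qn0 normr_ge0.
move: h8; rewrite ler_pM2r// => h8.
have -> : error_const * l = (p%:R * (`|eta0| + 1) * l) / (kappa / 4).
  by rewrite /error_const; field; rewrite gt_eqF.
by rewrite ler_pdivlMr ?divr_gt0// mulrC.
Qed.

Lemma objective_gap_le : fine (R w) <= r0 + p%:R * error_const * l.
Proof.
have h1 := optimality_gap.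
have h2 : 0 <= dot (A *m h) h.
  apply: le_trans (perturbed_coercive h).
  by rewrite mulr_ge0 ?sqr_ge0// divr_ge0// ltW.
have h3 : - (p%:R * `|g| * `|Q *m h|) <= dot g (Q *m h).
  by have := norm_dot_le g (Q *m h); rewrite ler_norml => /andP[].
have h4 : p%:R * `|g| * `|Q *m h| <= p%:R * l * (error_const * l).
  rewrite ler_pM ?mulr_ge0//; last exact: projected_error_le.
  exact: (ler_wpM2l (ler0n _ _) gl).
have : l * (fine (R w) - r0) <= l * (p%:R * error_const * l).
  by move: h1 h2 h3 h4; lra.
by rewrite ler_pM2l// lerBlDl.
Qed.

Hypothesis AC1 : `|A - C| <= 1.

Definition dual_const := 1 + p%:R * (`|C| + 1) * error_const.

Lemma etahat_norm_le : `|etahat l A g w| <= dual_const.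
Proof.
rewrite /etahat normrN normrZ gtr0_norm ?invr_gt0// ler_pdivrMl// -/h.
have h1 : `|A *m h| <= p%:R * (`|C| + 1) * (error_const * l).
  rewrite -AQ; apply: le_trans (mulmx_norm_le _ _) _.
  rewrite ler_pM ?mulr_ge0//; last exact: projected_error_le.
  rewrite ler_wpM2l//; have -> : A = C + (A - C) by rewrite addrC subrK.
  by apply: le_trans (ler_normD _ _) _; rewrite lerD2l.
apply: le_trans (ler_normD _ _) _; rewrite /dual_const.
by move: h1 gl; lra.
Qed.

(* Monotonicity of the subdifferential between [w] and [w0], with [Q *m h]
   recovered from [A *m h = - l *: etahat - g]. *)
Lemma dual_variational : dot (etahat l A g w - eta0) (X *m etahat l A g w) <=
  p%:R * (dual_const + `|eta0|) * (p%:R * `|X|) *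
    (`|g| / l + p%:R * `|A - C| * error_const).
Proof.
set eta := etahat l A g w.
have mono : 0 <= dot (eta - eta0) h.
  have e1 := etahat_subdiff l0 sA hw w0; have e2 := subdiff_w0 w.
  rewrite r0E (argmin_shifted_fin l0 hw) -!EFinD !lee_fin -/h in e1 e2.
  have -> : dot (eta - eta0) h = - dot eta (w0 - w) - dot eta0 h.
    by rewrite dotBl /h -(opprB w w0) dotNr opprK.
  by move: e1 e2; rewrite -/eta; lra.
have Qe : Q *m (eta - eta0) = eta - eta0.
  by rewrite mulmxBr Qeta0 etahat_image.
have AhE : A *m h = - (l *: eta) - g.
  rewrite /eta /etahat -/h scalerN opprK scalerA divff ?gt_eqF// scale1r.
  by rewrite addrAC subrr add0r.
have [z zE] : exists z, (A - C) *m (Q *m h) = z by eexists.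
have QhE : Q *m h = - (X *m (l *: eta)) - X *m (g + z).
  have CQ : C *m h = A *m h - z.
    by rewrite -zE (mulmxBl A C) AQ (mp_mulmx_proj sC mp) opprB addrC subrK.
  rewrite -(mp_comm sC mp) -(mulmxA X C h) CQ AhE.
  by rewrite -!mulmxN -mulmxDr opprD addrA.
have h1 : l * dot (eta - eta0) (X *m eta) <=
    - dot (eta - eta0) (X *m (g + z)).
  move: mono; rewrite -Qe (dot_projl mp) QhE dotBr dotNr -scalemxAr dotZr.
  by rewrite Qe; lra.
rewrite -(ler_pM2l l0); apply: (le_trans h1).
apply: le_trans (ler_norm _) _; rewrite normrN.
apply: le_trans (norm_dot_le _ _) _.
have h2 : `|eta - eta0| <= dual_const + `|eta0|.
  by apply: le_trans (ler_normB _ _) _; rewrite lerD2r etahat_norm_le.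
have h3 : `|g + z| <= `|g| + p%:R * `|A - C| * (error_const * l).
  apply: le_trans (ler_normD _ _) _; rewrite lerD2l -zE.
  apply: le_trans (mulmx_norm_le _ _) _.
  by rewrite ler_wpM2l ?mulr_ge0//; exact: projected_error_le.
have -> : l * (p%:R * (dual_const + `|eta0|) * (p%:R * `|X|) *
    (`|g| / l + p%:R * `|A - C| * error_const)) =
   (p%:R * (dual_const + `|eta0|)) * ((p%:R * `|X|) *
     (`|g| + p%:R * `|A - C| * (error_const * l))).
  by field; rewrite gt_eqF.
apply: ler_pM; rewrite ?mulr_ge0//.
  by rewrite ler_wpM2l.
apply: le_trans (mulmx_norm_le _ _) _.
by rewrite ler_wpM2l// mulr_ge0.
Qed.

End Estimates.

Section Limit.
Variables (l : nat -> K) (A : nat -> 'M[K]_p) (g : nat -> V).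
Hypotheses (l_pos : forall n, 0 < l n) (sA : forall n, (A n)^T = A n).
Hypotheses (QA : forall n, Q *m A n = A n) (Qg : forall n, Q *m g n = g n).
Hypotheses (l_cvg : l n @[n --> \oo] --> (0 : K))
  (g_cvg : `|g n| / l n @[n --> \oo] --> (0 : K))
  (A_cvg : `|A n - C| @[n --> \oo] --> (0 : K)).

Let eventually_small (u : nat -> K) (c e : K) :
  u n @[n --> \oo] --> (0 : K) -> 0 < e -> \forall n \near \oo, c * u n < e.
Proof.
move=> u0 e0; have : c * u n @[n --> \oo] --> c * 0 by apply: cvgMl_tmp.
rewrite mulr0 => /cvgrPdist_lt /(_ e e0); apply: filterS => n.
by rewrite sub0r normrN; apply: le_lt_trans; exact: ler_norm.
Qed.

(** The estimates say nothing on the kernel component. Locally on a sphere they are contradicted for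
    large [n], compactness makes the rank uniform, and convexity excludes minimizers beyond the
    sphere. *)
Lemma argmin_near_w0 (tau : K) : 0 < tau ->
  \forall n \near \oo, forall w,
    argmin (shifted_objective (l n) (A n) (g n)) [set: V] w -> `|w - w0| < tau.
Proof.
move=> tau0; have [kappa kappa0 coercive] := psd_coercive sC mp C0.
set B1 := error_const kappa.
have B10 : 0 <= B1.
  by rewrite /B1 /error_const !mulr_ge0 ?invr_ge0 ?addr_ge0// ltW.
pose sph : set V := [set w | `|w - w0| = tau].
have csph : compact sph.
  apply: (@cV_bounded_closed_compact _ _ _ (`|w0| + tau)).
    move=> w /= wt; rewrite -[w](subrK w0); apply: le_trans (ler_normD _ _) _.
    by rewrite wt addrC.
  have -> : sph = (fun w : V => `|w - w0|) @^-1` [set tau] by [].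
  have cn : continuous (fun w : V => `|w - w0|) := @dist_continuous _ _ w0.
  by move/continuous_closedP: cn; apply; exact: closed_eq.
(* [Bad n] fails near every point of the sphere for large [n], hence on the
   whole sphere, which the segment from [w0] to a far minimizer would cross. *)
pose Bad n w := (R w <= (r0 + p%:R * B1 * l n)%:E)%E /\ `|Q *m (w - w0)| <= B1 * l n.
have nsph : \forall n \near \oo, sph `<=` (fun w => ~ Bad n w).
  move/compact_near_coveringP : csph; apply=> w /= wt.
  (* Along the kernel, uniqueness gives [R w0 < R w] and semicontinuity preserves a gap nearby; in
     other directions the projected error stays away from 0. *)
  have [Qw|Qw] := eqVneq (Q *m (w - w0)) 0.
    have Rw : (R w0 < R w)%E.
      rewrite ltNge; apply/negP => Rw.
      have Cw : C *m (w - w0) = 0 by rewrite -(mp_mulmx_proj sC mp) Qw mulmx0.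
      by move: tau0; rewrite -wt (uniq_w0 Cw Rw) subrr normr0 ltxx.
    have [a r0a aR] : exists2 a, r0 < a & (a%:E < R w)%E.
      move: Rw; rewrite r0E; case: (R w) => [s| |]//; last first.
        by move=> _; exists (r0 + 1); rewrite ?ltry// ltrDl.
      rewrite lte_fin => r0s; exists (2^-1 * (r0 + s)); rewrite ?lte_fin; lra.
    have [U Uw UR] := hlsc aR.
    have small : \forall n \near \oo, p%:R * B1 * l n < a - r0.
      by apply: eventually_small => //; rewrite subr_gt0.
    exists (U, [set n | p%:R * B1 * l n < a - r0]); first by split.
    move=> [w' n] /= [Uw' hn] [Rw' _].
    have := lt_le_trans (UR _ Uw') Rw'; rewrite lte_fin; lra.
  have q0 : 0 < `|Q *m (w - w0)| by rewrite normr_gt0.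
  set q := `|Q *m (w - w0)| in q0.
  have small : \forall n \near \oo, B1 * l n < q / 2.
    by apply: eventually_small => //; rewrite divr_gt0.
  have m0 : 0 < p%:R * `|Q| + 1 by rewrite ltr_wpDl// mulr_ge0.
  exists ([set w' | `|w - w'| < q / 2 / (p%:R * `|Q| + 1)],
          [set n | B1 * l n < q / 2]).
    split => //=; apply: (@near_norm _ _ _ (q / 2 / (p%:R * `|Q| + 1))) => //.
    by rewrite !divr_gt0.
  move=> [w' n] /= [ww' hn] [_ Qw'].
  have : q <= `|Q *m (w - w')| + `|Q *m (w' - w0)|.
    apply: le_trans (ler_normD _ _).
    by rewrite -mulmxDr addrA subrK.
  have : `|Q *m (w - w')| < q / 2.
    apply: le_lt_trans (mulmx_norm_le _ _) _.
    move: ww'; rewrite ltr_pdivlMr//; apply: le_lt_trans.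
    by rewrite mulrC ler_wpM2l// lerDl.
  by move: hn Qw'; lra.
have gl : \forall n \near \oo, 1 * (`|g n| / l n) < 1 by exact: eventually_small.
have AC : \forall n \near \oo, p%:R * p%:R * `|A n - C| < kappa / 2.
  by apply: eventually_small => //; rewrite divr_gt0.
apply: filterS3 gl AC nsph => n gl AC nsph w hw.
rewrite mul1r ltr_pdivrMr// mul1r in gl; rewrite -mulrA in AC.
have p1 := projected_error_le kappa0 coercive (l_pos n) (sA n) (QA n) (Qg n)
  (ltW gl) (ltW AC) hw.
have p2 := objective_gap_le kappa0 coercive (l_pos n) (sA n) (QA n) (Qg n)
  (ltW gl) (ltW AC) hw.
rewrite ltNge; apply/negP => tauw.
have h0 : 0 < `|w - w0| by exact: lt_le_trans tauw.
pose t := tau / `|w - w0|.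
have t0 : 0 < t by rewrite divr_gt0.
have t1 : t <= 1 by rewrite ler_pdivrMr// mul1r.
have tw : t *: w + (1 - t) *: w0 - w0 = t *: (w - w0).
  by apply/matrixP => i j; rewrite !mxE; ring.
apply: (nsph (t *: w + (1 - t) *: w0)).
  by rewrite /sph/= tw normrZ gtr0_norm// /t divfK// gt_eqF.
split.
  apply: le_trans (hconvex _ _ _) _; first by rewrite ltW.
  rewrite (argmin_shifted_fin (l_pos n) hw) r0E -!EFinM -EFinD lee_fin.
  have c0 : 0 <= p%:R * B1 * l n by exact: mulr_ge0 (mulr_ge0 _ B10) (ltW (l_pos n)).
  by rewrite -/B1 in p2; nra.
rewrite tw -scalemxAr normrZ gtr0_norm//.
apply: le_trans p1; rewrite -[leRHS]mul1r.
by rewrite ler_wpM2r.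
Qed.

Let near_scaled_dist (x : V) (c e : K) : 0 <= c -> 0 < e ->
  \forall y \near x, c * `|x - y| < e.
Proof.
move=> c0 e0; have c1 : 0 < c + 1 by rewrite ltr_wpDl.
apply: (@near_norm _ _ _ (e / (c + 1))) => [|y]; first exact: divr_gt0.
rewrite ltr_pdivlMr// mulrC; apply: le_lt_trans.
by rewrite ler_wpM2r// lerDl.
Qed.

(** Certificates are bounded, so those far from [eta0] lie in a compact annulus. Each of its points
    has a neighbourhood eventually free of certificates, for one of three reasons: it is outside
    [Im C]; it is outside [subdiff R w0], whose inequalities pass to the limit as minimizers
    approach [w0]; or it is feasible, and [dual_variational] fails there. *)
Lemma etahat_near_eta0 (eps : K) : 0 < eps ->
  \forall n \near \oo, forall w,
    argmin (shifted_objective (l n) (A n) (g n)) [set: V] w ->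
    `|etahat (l n) (A n) (g n) w - eta0| < eps.
Proof.
move=> eps0; have [kappa kappa0 coercive] := psd_coercive sC mp C0.
set B2 := dual_const kappa.
pose ann : set V := [set eta | eps <= `|eta - eta0|] `&` [set eta | `|eta| <= B2].
have cont_dist (x0 : V) : continuous (fun x : V => `|x - x0|) := @dist_continuous _ _ x0.
have cann : compact ann.
  apply: (@cV_bounded_closed_compact _ _ _ B2); first by move=> x [].
  apply: closedI.
    have /continuous_closedP h := cont_dist eta0.
    by apply: (h [set y | eps <= y]); exact: closed_ge.
  rewrite (_ : [set _ | _] = (fun x : V => `|x - 0|) @^-1` [set y | y <= B2]).
    have /continuous_closedP h := cont_dist 0.
    by apply: (h [set y | y <= B2]); exact: closed_le.
  by apply/seteqP; split => x /=; rewrite subr0.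
pose Bad n eta := exists2 w, argmin (shifted_objective (l n) (A n) (g n)) [set: V] w &
  etahat (l n) (A n) (g n) w = eta.
have gl : \forall n \near \oo, `|g n| <= l n.
  have : \forall n \near \oo, 1 * (`|g n| / l n) < 1 by exact: eventually_small.
  by apply: filterS => n; rewrite mul1r ltr_pdivrMr// mul1r => /ltW.
have AC : \forall n \near \oo, p%:R * (p%:R * `|A n - C|) <= kappa / 2.
  have : \forall n \near \oo, p%:R * p%:R * `|A n - C| < kappa / 2.
    by apply: eventually_small => //; rewrite divr_gt0.
  by apply: filterS => n; rewrite -mulrA => /ltW.
have AC1 : \forall n \near \oo, `|A n - C| <= 1.
  have : \forall n \near \oo, 1 * `|A n - C| < 1 by exact: eventually_small.
  by apply: filterS => n; rewrite mul1r => /ltW.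
have nann : \forall n \near \oo, ann `<=` (fun eta => ~ Bad n eta).
  move/compact_near_coveringP : cann; apply=> eta [/= eps_eta _].
  have [Qe|Qe] := eqVneq (Q *m eta) eta; last first.
    set q := `|Q *m eta - eta|.
    have q0 : 0 < q by rewrite normr_gt0 subr_eq0.
    exists ([set eta' | (p%:R * `|Q| + 1) * `|eta - eta'| < q], setT).
      split; last exact: filterT.
      by apply: near_scaled_dist => //; rewrite addr_ge0// mulr_ge0.
    move=> [eta' n] /= [close _] [w _ etaE].
    have Qe' : Q *m eta' = eta' by rewrite -etaE etahat_image.
    have : q <= `|Q *m (eta - eta')| + `|eta - eta'|.
      rewrite /q mulmxBr Qe'; apply: le_trans (ler_normB _ _).
      by rewrite opprB addrA subrK.
    have := mulmx_norm_le Q (eta - eta').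
    by move: close; rewrite mulrDl mul1r; lra.
  have [sub_eta|nsub] := pselect (subdiff R w0 eta); last first.
    have [v hv] : exists v, ~~ (R w0 + (dot eta (v - w0))%:E <= R v)%E.
      by apply: contrapT => h; apply: nsub => v; apply: contrapT => /negP h'; apply: h; exists v.
    rewrite r0E in hv.
    have [s Rv] : exists s, R v = s%:E.
      have := hproper.1 v; move: hv; case: (R v) => [s| |]//; first by exists s.
      by rewrite leey.
    rewrite Rv -EFinD lee_fin -ltNge in hv.
    (* A quarter of the violation at [v]: semicontinuity of [R], the move from [eta] to [eta'] and
       the move from [w0] to [w] cost at most one [gap] each. *)
    set gap := (r0 + dot eta (v - w0) - s) / 4.
    have gap0 : 0 < gap by rewrite divr_gt0// subr_gt0.
    have : ((r0 - gap)%:E < R w0)%E by rewrite r0E lte_fin; lra.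
    move=> /hlsc [U /nbhs_normP[t1 /= t10 hU] UR].
    set c := p%:R * (`|eta| + 1) + 1.
    have c0 : 0 < c by rewrite ltr_wpDl// mulr_ge0// addr_ge0.
    have t20 : 0 < Num.min t1 (gap / c) by rewrite lt_min t10 divr_gt0.
    have nearw := argmin_near_w0 t20.
    have e1 : \forall eta' \near eta, p%:R * `|v - w0| * `|eta - eta'| < gap.
      by apply: near_scaled_dist => //; rewrite mulr_ge0.
    have e2 : \forall eta' \near eta, 1 * `|eta - eta'| < 1.
      exact: near_scaled_dist.
    exists ([set eta' | p%:R * `|v - w0| * `|eta - eta'| < gap] `&`
            [set eta' | 1 * `|eta - eta'| < 1],
            [set n | forall w, argmin (shifted_objective (l n) (A n) (g n)) [set: V] w ->
               `|w - w0| < Num.min t1 (gap / c)]).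
      by split => //; apply: filterI.
    move=> [eta' n] /= [[h1 h2] hn] [w hw etaE].
    have := hn w hw; rewrite lt_min => /andP[w1 w2].
    have Rw := UR w (hU w _); rewrite /= distrC in Rw; have {}Rw := Rw w1.
    have := etahat_subdiff (l_pos n) (sA n) hw v; rewrite etaE.
    move: Rw; rewrite (argmin_shifted_fin (l_pos n) hw) Rv lte_fin -EFinD lee_fin => Rw hs.
    have d1 : dot eta' (v - w) = dot eta (v - w0) - dot (v - w0) (eta - eta') - dot eta' (w - w0).
      rewrite (dotC (v - w0)) dotBl.
      have -> : v - w = (v - w0) - (w - w0) by rewrite opprB addrA subrK.
      by rewrite (dotBr eta' (v - w0)); lra.
    have d2 := dot_le (v - w0) (eta - eta').
    have d3 := dot_le eta' (w - w0).
    have n1 : `|eta'| <= `|eta| + 1.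
      have : `|eta'| <= `|eta| + `|eta - eta'|.
        by apply: le_trans (ler_normB _ _); rewrite opprB addrC subrK.
      by move: h2; rewrite mul1r; lra.
    have d4 : p%:R * `|eta'| * `|w - w0| <= gap.
      apply: (@le_trans _ _ (c * `|w - w0|)).
        rewrite ler_wpM2r// /c; have := ler_wpM2l (ler0n K p) n1; lra.
      by rewrite mulrC -ler_pdivlMr// ltW.
    have gE : r0 + dot eta (v - w0) - s = 4 * gap by rewrite /gap; field.
    rewrite d1 in hs; move: gE hs Rw d2 d3 d4 h1 gap0; clearbody gap; lra.
  (* Twice [q] is the difference of the dual objectives at [eta] and [eta0], nonnegative by
     minimality, plus the form [X] at [eta - eta0], positive by definiteness. *)
  set q := dot (eta - eta0) (X *m eta).
  have q0 : 0 < q.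
    have [_ hmin] := heta0.
    have := hmin eta (conj sub_eta _); rewrite /dual_objective lee_fin => /(_ _) le0.
    have {}le0 : dot (X *m eta0) eta0 <= dot (X *m eta) eta.
      by apply: le0; exists (X *m eta) => //; rewrite mulmxA.
    have pd : 0 < dot (X *m (eta - eta0)) (eta - eta0).
      rewrite lt_def (mp_psd sC mp C0) andbT; apply/eqP => h0.
      have := mp_pd sC mp C0 _ h0; rewrite mulmxBr Qe Qeta0 => /(_ erefl) eta_eq.
      by move: eps_eta; rewrite eta_eq normr0 leNgt eps0.
    have Xs := mp_sym sC mp.
    have eX : dot (X *m eta) eta0 = dot (X *m eta0) eta.
      by rewrite (dot_mulmx_sym _ _ Xs) dotC.
    have qE : q = dot (X *m eta) eta - dot (X *m eta) eta0 by rewrite /q dotC dotBr.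
    by move: pd; rewrite mulmxBr !dotBl !dotBr eX qE; rewrite eX; lra.
  set D := p%:R * (B2 + `|eta0|) * (p%:R * `|X|).
  set c2 := p%:R * error_const kappa.
  (* Half of [q] is spent on the two error terms of [dual_variational], the other half on replacing
     [eta] by the certificate [eta']. *)
  have s1 : \forall n \near \oo, D * (`|g n| / l n) < q / 4.
    by apply: eventually_small => //; rewrite divr_gt0.
  have s2 : \forall n \near \oo, D * c2 * `|A n - C| < q / 4.
    by apply: eventually_small => //; rewrite divr_gt0.
  set c3 := p%:R * (p%:R * `|X| * (`|eta| + 1)) + p%:R * `|eta - eta0| * (p%:R * `|X|).
  have c30 : 0 <= c3 by rewrite addr_ge0// !mulr_ge0// addr_ge0.
  have e1 : \forall eta' \near eta, c3 * `|eta - eta'| < q / 2.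
    by apply: near_scaled_dist => //; rewrite divr_gt0.
  have e2 : \forall eta' \near eta, 1 * `|eta - eta'| < 1 by exact: near_scaled_dist.
  exists ([set eta' | c3 * `|eta - eta'| < q / 2] `&` [set eta' | 1 * `|eta - eta'| < 1],
    [set n | D * (`|g n| / l n) < q / 4] `&` [set n | D * c2 * `|A n - C| < q / 4] `&`
    ([set n | `|g n| <= l n] `&` [set n | p%:R * (p%:R * `|A n - C|) <= kappa / 2] `&`
     [set n | `|A n - C| <= 1])).
    by split; [exact: filterI|apply: filterI; apply: filterI => //; exact: filterI].
  move=> [eta' n] /= [[h1 h2] [[n1 n2] [[n3 n4] n5]]] [w hw etaE].
  have := dual_variational kappa0 coercive (l_pos n) (sA n) (QA n) (Qg n) n3 n4 hw n5.
  rewrite etaE -/B2 -/D => dv.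
  have dE : dot (eta' - eta0) (X *m eta') =
      q - dot (eta - eta') (X *m eta') - dot (eta - eta0) (X *m (eta - eta')).
    by rewrite /q !mulmxBr !dotBl !dotBr; lra.
  have n6 : `|eta'| <= `|eta| + 1.
    have : `|eta'| <= `|eta| + `|eta - eta'|.
      by apply: le_trans (ler_normB _ _); rewrite opprB addrC subrK.
    by move: h2; rewrite mul1r; lra.
  have d1 : dot (eta - eta') (X *m eta') <= p%:R * (p%:R * `|X| * (`|eta| + 1)) * `|eta - eta'|.
    apply: le_trans (dot_le _ _) _; rewrite mulrAC ler_wpM2r//.
    rewrite ler_wpM2l//; apply: le_trans (mulmx_norm_le _ _) _.
    by rewrite ler_wpM2l// mulr_ge0.
  have d2 : dot (eta - eta0) (X *m (eta - eta')) <=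
      p%:R * `|eta - eta0| * (p%:R * `|X|) * `|eta - eta'|.
    apply: le_trans (dot_le _ _) _; rewrite -[leRHS]mulrA ler_wpM2l ?mulr_ge0//.
    exact: mulmx_norm_le.
  by move: dv h1 n1 n2; rewrite dE /c3 /c2; lra.
apply: filterS3 (filterI gl AC) AC1 nann => n [gln ACn] AC1n nannn w hw.
rewrite ltNge; apply/negP => far.
apply: (nannn (etahat (l n) (A n) (g n) w)); last by exists w.
split => //=.
exact: (etahat_norm_le kappa0 coercive (l_pos n) (sA n) (QA n) (Qg n) gln ACn hw AC1n).
Qed.

End Limit.
End Convergence.

(** * Population and empirical quantities *)

Section Population.
Context {K : realType} {p : nat}.
Local Notation V := 'cV[K]_p.
Local Notation T := (sample_space K p).
Variables (rho : probability T K) (w0 : V).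
Hypothesis hx4 : ('E_rho[fun z => (enorm (inp z) ^+ 4)%R] < +oo)%E.
Hypothesis hy4 : ('E_rho[fun z => (`|out z| ^+ 4)%R] < +oo)%E.

Lemma measurable_inp i : measurable_fun [set: T] (fun z : T => inp z i 0 : K).
Proof.
have mc : measurable_fun [set: g_sigma_algebraType (@open 'cV[K]_p)]
    (fun x : g_sigma_algebraType (@open 'cV[K]_p) => (x : 'cV[K]_p) i 0 : K).
  apply: (measurability _ (RGenOInfty.measurableE K)).
  move=> _ [_ [a ->] <-]; rewrite setTI; apply: sub_sigma_algebra => /=.
  rewrite preimage_itvoy.
  have /continuousP h := @coord_continuous K p 1 i 0.
  by apply: (h [set y | a < y]); exact: open_gt.
exact: (measurableT_comp mc measurable_fst).
Qed.

Lemma measurable_out : measurable_fun [set: T] (fun z : T => out z : K).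
Proof. exact: measurable_snd. Qed.

Lemma measurable_dot_inp v : measurable_fun [set: T] (fun z : T => dot (inp z) v).
Proof.
apply: measurable_sum => i.
by apply: measurable_funM => //; exact: measurable_inp.
Qed.

Lemma measurable_sqr_inp : measurable_fun [set: T] (fun z : T => dot (inp z) (inp z)).
Proof.
apply: measurable_sum => i.
by apply: measurable_funM; exact: measurable_inp.
Qed.

Definition residual (z : T) : K := dot (inp z) w0 - out z.

Lemma measurable_residual : measurable_fun [set: T] residual.
Proof.
by apply: measurable_funB; [exact: measurable_dot_inp|exact: measurable_out].
Qed.

(** A single integrable majorant, with [|x| ^ 4] written as [dot x x ^ 2]. It dominates the squares
    of all averaged products; the constant 1 also absorbs second-order terms. *)
Definition envelope (z : T) : K := dot (inp z) (inp z) ^+ 2 + out z ^+ 4 + 1.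

Lemma measurable_envelope : measurable_fun [set: T] envelope.
Proof.
apply: measurable_funD => //; apply: measurable_funD; apply: measurable_funX.
  exact: measurable_sqr_inp.
exact: measurable_out.
Qed.

Lemma envelope_ge0 z : 0 <= envelope z.
Proof. by rewrite !addr_ge0// ?sqr_ge0// (exprn_even_ge0 (out z) (isT : ~~ odd 4)). Qed.

Lemma integrable_envelope : (\int[rho]_z (envelope z)%:E < +oo)%E.
Proof.
move: hx4 hy4; rewrite unlock => hx hy.
rewrite /envelope; under eq_integral do rewrite !EFinD.
have m1 : measurable_fun [set: T] (fun z => (dot (inp z) (inp z) ^+ 2)%:E).
  by apply/measurable_EFinP; apply: measurable_funX; exact: measurable_sqr_inp.
have m2 : measurable_fun [set: T] (fun z => (out z ^+ 4)%:E).
  by apply/measurable_EFinP; apply: measurable_funX; exact: measurable_out.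
have p1 z : (0 <= (dot (inp z) (inp z) ^+ 2 : K)%:E)%E by rewrite lee_fin sqr_ge0.
have p2 z : (0 <= (out z ^+ 4)%:E)%E.
  by rewrite lee_fin (exprn_even_ge0 (out z) (isT : ~~ odd 4)).
rewrite ge0_integralD//; last 2 first.
  by move=> z _; rewrite adde_ge0.
  exact: emeasurable_funD.
rewrite ge0_integralD// integral_cst//= probability_setT mule1.
have -> : (\int[rho]_z (dot (inp z) (inp z) ^+ 2 : K)%:E =
    \int[rho]_z (enorm (inp z) ^+ 4 : K)%:E)%E.
  by apply: eq_integral => z _; rewrite /enorm (exprM _ 2 2) sqr_sqrtr ?dot_ge0.
have -> : (\int[rho]_z (out z ^+ 4)%:E = \int[rho]_z (`|out z| ^+ 4)%:E)%E.
  apply: eq_integral => z _.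
  by rewrite (exprM `|_| 2 2) real_normK ?num_real// -exprM.
apply: lte_add_pinfty; last exact: ltry.
exact: lte_add_pinfty.
Qed.

Lemma dominated_integrable (f : T -> K) (c : K) : measurable_fun [set: T] f ->
  (forall z, `|f z| <= c * envelope z) -> rho.-integrable [set: T] (EFin \o f).
Proof.
move=> mf fc.
have ie : rho.-integrable [set: T] (EFin \o envelope).
  apply: ge0_integrable => //.
  - exact: measurable_envelope.
  - exact: envelope_ge0.
  - exact: integrable_envelope.
have ice := integrableZl measurableT c ie.
apply: le_integrable ice => //; first exact/measurable_EFinP.
by move=> z _; rewrite /= lee_fin (le_trans (fc z))// ler_norm.
Qed.

Lemma dominated_sqr (f : T -> K) (c : K) : measurable_fun [set: T] f ->
  (forall z, f z ^+ 2 <= c * envelope z) -> (\int[rho]_z (f z ^+ 2)%:E < +oo)%E.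
Proof.
move=> mf fc; have : rho.-integrable [set: T] (EFin \o (fun z => f z ^+ 2)).
  apply: (@dominated_integrable _ c); first exact: measurable_funX.
  by move=> z; rewrite ger0_norm ?sqr_ge0.
move=> /integrableP[_].
by under eq_integral do rewrite /= (ger0_norm (sqr_ge0 _)).
Qed.

Lemma prod_coord_sqr_le i j z :
  (inp z i 0 * inp z j 0) ^+ 2 <= 1 * envelope z :> K.
Proof.
rewrite mul1r exprMn /envelope.
have y4 : 0 <= out z ^+ 4 := exprn_even_ge0 (out z) (isT : ~~ odd 4).
have : inp z i 0 ^+ 2 * inp z j 0 ^+ 2 <= dot (inp z) (inp z) ^+ 2.
  by rewrite [leRHS]expr2 ler_pM ?sqr_ge0// sqr_coord_le_dot.
by move=> h; rewrite (le_trans h)// -addrA lerDl addr_ge0.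
Qed.

Lemma dot_sqr_le (u v : V) : dot u v ^+ 2 <= dot u u * dot v v.
Proof.
have := @psd_cauchy_schwarz K p 1%:M u v; rewrite !mul1mx; apply.
  exact: trmx1.
by move=> w; rewrite mul1mx dot_ge0.
Qed.

Lemma residual_sqr_le z :
  residual z ^+ 2 <= 2 * dot w0 w0 * dot (inp z) (inp z) + 2 * out z ^+ 2.
Proof.
have h := dot_sqr_le (inp z) w0.
have : residual z ^+ 2 <= 2 * dot (inp z) w0 ^+ 2 + 2 * out z ^+ 2.
  rewrite /residual; have := sqr_ge0 (dot (inp z) w0 + out z).
  by rewrite !expr2; lra.
by move: h; lra.
Qed.

Lemma residual_sqr_envelope z : residual z ^+ 2 <= (dot w0 w0 + 1) * envelope z.
Proof.
apply: le_trans (residual_sqr_le z) _; rewrite /envelope.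
have W0 := dot_ge0 w0; set W := dot w0 w0 in W0 *.
set s := dot (inp z) (inp z).
have s1 : 2 * s <= s ^+ 2 + 1 by have := sqr_ge0 (s - 1); rewrite !expr2; lra.
have y1 : 2 * out z ^+ 2 <= out z ^+ 4 + 1.
  rewrite (exprM _ 2 2); have := sqr_ge0 (out z ^+ 2 - 1).
  by rewrite !(expr2 (_ - _)) !(expr2 (out z ^+ 2)); lra.
have y4 : 0 <= out z ^+ 4 := exprn_even_ge0 (out z) (isT : ~~ odd 4).
have h1 := ler_wpM2l W0 s1.
have h2 : 0 <= W * out z ^+ 4 by rewrite mulr_ge0.
by have := sqr_ge0 s; lra.
Qed.

Lemma residual_inp_sqr_le i z :
  (residual z * inp z i 0) ^+ 2 <= (2 * dot w0 w0 + 1) * envelope z.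
Proof.
rewrite exprMn /envelope.
have W0 := dot_ge0 w0.
have s0 := dot_ge0 (inp z); have hr := residual_sqr_le z.
have hi := sqr_coord_le_dot (inp z) i.
move: W0 s0 hr hi; set W := dot w0 w0; set s := dot (inp z) (inp z) => W0 s0 hr hi.
have y4 : 0 <= out z ^+ 4 := exprn_even_ge0 (out z) (isT : ~~ odd 4).
apply: (@le_trans _ _ ((2 * W * s + 2 * out z ^+ 2) * s)).
  by rewrite ler_pM ?sqr_ge0.
have y1 : 2 * out z ^+ 2 * s <= out z ^+ 4 + s ^+ 2.
  rewrite (exprM _ 2 2); have := sqr_ge0 (out z ^+ 2 - s).
  by rewrite !(expr2 (_ - _)) !(expr2 (out z ^+ 2)) (expr2 s); lra.
have h2 : 0 <= W * out z ^+ 4 by rewrite mulr_ge0.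
by move: y1; rewrite (expr2 s); lra.
Qed.

Lemma measurable_prod_coord i j :
  measurable_fun [set: T] (fun z : T => inp z i 0 * inp z j 0 : K).
Proof. by apply: measurable_funM; exact: measurable_inp. Qed.

Lemma measurable_residual_inp i :
  measurable_fun [set: T] (fun z : T => residual z * inp z i 0).
Proof. by apply: measurable_funM; [exact: measurable_residual|exact: measurable_inp]. Qed.

Lemma integrable_prod_coord i j :
  rho.-integrable [set: T] (EFin \o (fun z : T => inp z i 0 * inp z j 0 : K)).
Proof.
apply: sqr_integrable_integrable; first exact: measurable_prod_coord.
by apply: (@dominated_sqr _ 1); [exact: measurable_prod_coord|exact: prod_coord_sqr_le].
Qed.

Lemma integrable_residual_inp i :
  rho.-integrable [set: T] (EFin \o (fun z : T => residual z * inp z i 0)).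
Proof.
apply: sqr_integrable_integrable; first exact: measurable_residual_inp.
apply: (@dominated_sqr _ (2 * dot w0 w0 + 1)); first exact: measurable_residual_inp.
exact: residual_inp_sqr_le.
Qed.

Lemma integrable_residual_sqr :
  rho.-integrable [set: T] (EFin \o (fun z : T => residual z ^+ 2)).
Proof.
apply: (@dominated_integrable _ (dot w0 w0 + 1)).
  by apply: measurable_funX; exact: measurable_residual.
by move=> z; rewrite ger0_norm ?sqr_ge0// residual_sqr_envelope.
Qed.

Local Notation C := (second_moment rho).

Lemma integral_prod_coord i j :
  (\int[rho]_z (inp z i 0 * inp z j 0 : K)%:E = (C i j)%:E)%E.
Proof.
rewrite mxE unlock.
have -> : (fun z : T => ((inp z *m (inp z)^T) i j : K)%:E) =
    (EFin \o (fun z : T => inp z i 0 * inp z j 0 : K)).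
  by apply/funext => z /=; rewrite mxE big_ord1 mxE.
by rewrite fineK// (integrable_fin_num measurableT (integrable_prod_coord i j)).
Qed.

Definition gradient : V :=
  \col_i fine (\int[rho]_z (residual z * inp z i 0)%:E)%E.

Lemma integral_residual_inp i :
  (\int[rho]_z (residual z * inp z i 0)%:E = (gradient i 0)%:E)%E.
Proof.
by rewrite mxE fineK// (integrable_fin_num measurableT (integrable_residual_inp i)).
Qed.

Lemma integral_lincomb (n : nat) (c m : 'I_n -> K) (f : 'I_n -> T -> K) :
  (forall i, rho.-integrable [set: T] (EFin \o f i)) ->
  (forall i, (\int[rho]_z (f i z)%:E = (m i)%:E)%E) ->
  rho.-integrable [set: T] (EFin \o (fun z => \sum_i c i * f i z)) /\
  (\int[rho]_z (\sum_i c i * f i z)%:E = (\sum_i c i * m i)%:E)%E.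
Proof.
move=> fi fm.
have E : (EFin \o (fun z => \sum_i c i * f i z)) =
    (fun z => \sum_(i < n) ((c i)%:E * (f i z)%:E))%E.
  by apply/funext => z /=; rewrite -sumEFin.
have ci i : rho.-integrable [set: T] (fun z => (c i)%:E * (f i z)%:E)%E.
  exact: (integrableZl measurableT (c i) (fi i)).
split; first by rewrite E; apply: integrable_sum.
transitivity (\int[rho]_z (\sum_(i < n) ((c i)%:E * (f i z)%:E)))%E.
  by apply: eq_integral => z _; rewrite -sumEFin.
rewrite integral_sum// -sumEFin; apply: eq_bigr => i _.
by rewrite (integralZl measurableT (fi i)) fm.
Qed.

Lemma integral_dot_sqr h :
  rho.-integrable [set: T] (EFin \o (fun z : T => dot (inp z) h ^+ 2)) /\
  (\int[rho]_z (dot (inp z) h ^+ 2)%:E = (dot (C *m h) h)%:E)%E.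
Proof.
have inner i := integral_lincomb (fun j => h j 0) (integrable_prod_coord i)
  (integral_prod_coord i).
have := integral_lincomb (fun i => h i 0) (fun i => (inner i).1) (fun i => (inner i).2).
have -> : (fun z : T => \sum_i h i 0 * (\sum_j h j 0 * (inp z i 0 * inp z j 0))) =
    (fun z : T => dot (inp z) h ^+ 2).
  apply/funext => z; rewrite expr2 /dot mulr_suml; apply: eq_bigr => i _.
  by rewrite !mulr_sumr; apply: eq_bigr => j _; ring.
have -> : \sum_i h i 0 * (\sum_j h j 0 * C i j) = dot (C *m h) h.
  rewrite /dot; apply: eq_bigr => i _; rewrite mulrC mxE; congr (_ * _).
  by apply: eq_bigr => j _; rewrite mulrC.
move=> [i1 i2]; split => //; rewrite -i2; apply: eq_integral => z _; congr EFin.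
rewrite expr2 /dot mulr_suml; apply: eq_bigr => i _.
by rewrite !mulr_sumr; apply: eq_bigr => j _; ring.
Qed.

Lemma second_moment_sym : C^T = C.
Proof.
apply/matrixP => i j; apply: EFin_inj; rewrite mxE -!integral_prod_coord.
by apply: eq_integral => z _; rewrite mulrC.
Qed.

Lemma second_moment_psd h : 0 <= dot (C *m h) h.
Proof.
rewrite -lee_fin -(integral_dot_sqr h).2; apply: integral_ge0 => z _.
by rewrite lee_fin sqr_ge0.
Qed.

Lemma population_risk_expansion : exists c0 : K, forall h,
  population_risk rho (w0 + h) = (c0 + 2 * dot gradient h + dot (C *m h) h)%:E.
Proof.
exists (fine (\int[rho]_z (residual z ^+ 2)%:E)%E) => h.
rewrite /population_risk unlock.
have [ih eh] := integral_dot_sqr h.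
have [il el] := integral_lincomb (fun i => h i 0) integrable_residual_inp
  integral_residual_inp.
have ir := integrable_residual_sqr.
transitivity (\int[rho]_z ((residual z ^+ 2)%:E +
    (2%:E * (\sum_i h i 0 * (residual z * inp z i 0))%:E) + (dot (inp z) h ^+ 2)%:E))%E.
  apply: eq_integral => z _; rewrite -EFinM -!EFinD; congr EFin.
  have -> : dot (w0 + h) (inp z) - out z = residual z + dot (inp z) h.
    by rewrite dotDl !(dotC _ (inp z)) /residual; ring.
  have -> : \sum_i h i 0 * (residual z * inp z i 0) = residual z * dot (inp z) h.
    by rewrite /dot mulr_sumr; apply: eq_bigr => i _; ring.
  by ring.
have il2 := integrableZl measurableT 2 il.
rewrite (integralD measurableT (integrableD measurableT ir il2) ih).
rewrite (integralD measurableT ir il2) (integralZl measurableT il)/= el eh.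
have -> : \sum_i h i 0 * gradient i 0 = dot gradient h.
  by apply: eq_bigr => i _; rewrite mulrC.
rewrite -[X in (X + _ + _)%E]fineK ?(integrable_fin_num measurableT ir)//.
Qed.

Hypothesis w0_min : argmin (population_risk rho) [set: V] w0.

(** The normal equations, from small steps along the negative gradient. They centre the variables
    averaged in [sample_gradient], so that it is itself the fluctuation to be compared with
    [lambda n]. *)
Lemma gradient_eq0 : gradient = 0.
Proof.
have [c0 hr] := population_risk_expansion.
apply: dot_eq0; apply/eqP; rewrite eq_le dot_ge0 andbT leNgt; apply/negP => g0.
set a := dot (C *m gradient) gradient.
have a0 : 0 <= a by exact: second_moment_psd.
have key t : 0 < t -> 2 * dot gradient gradient <= t * a.
  move=> t0; have [_ /(_ (w0 + (- t) *: gradient) I)] := w0_min.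
  have -> : population_risk rho w0 = (c0 + 2 * dot gradient 0 + dot (C *m 0) 0)%:E.
    by rewrite -hr addr0.
  rewrite hr lee_fin !dot0r -scalemxAr !dotZr dotZl -/a => h.
  by rewrite -(ler_pM2l t0); move: h; lra.
have a1 : 0 < a + 1 by rewrite ltr_wpDl.
have := key (dot gradient gradient / (a + 1)) (divr_gt0 g0 a1).
have : dot gradient gradient / (a + 1) * a <= dot gradient gradient.
  by rewrite mulrAC ler_pdivrMr// ler_pM2l//; lra.
by lra.
Qed.

Lemma population_risk_kernel h : C *m h = 0 ->
  population_risk rho (w0 + h) = population_risk rho w0.
Proof.
have [c0 hr] := population_risk_expansion => Ch.
have -> : population_risk rho w0 = population_risk rho (w0 + 0) by rewrite addr0.
by rewrite !hr gradient_eq0 Ch mulmx0 !dot0l.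
Qed.

(** For [r] in the kernel of [C] the variable [dot x r] has second moment [dot (C *m r) r = 0]. The
    finitely many projections of basis vectors onto the kernel are enough. *)
Lemma ae_inp_image X : is_moore_penrose C X ->
  {ae rho, forall z : T, C *m X *m inp z = inp z}.
Proof.
move=> mp; have sC := second_moment_sym.
have [CXC _ sQ _] := mp.
pose r (i : 'I_p) : V := delta_mx i 0 - C *m X *m delta_mx i 0.
have Cr i : C *m r i = 0.
  by rewrite /r mulmxBr (mp_mulmx_proj sC mp) subrr.
have rE i z : dot (inp z) (r i) = (inp z - C *m X *m inp z) i 0.
  have de (u : V) : dot u (delta_mx i 0) = u i 0.
    rewrite /dot (bigD1 i)//= mxE !eqxx mulr1 big1 ?addr0// => j ji.
    by rewrite mxE (negbTE ji) mulr0.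
  by rewrite dotBr de -(dot_projl mp) de !mxE.
have aei i : {ae rho, forall z : T, dot (inp z) (r i) = 0}.
  have [_ e0] := integral_dot_sqr (r i); rewrite Cr dot0l in e0.
  have mf : measurable_fun [set: T] (fun z : T => (dot (inp z) (r i) ^+ 2)%:E).
    by apply/measurable_EFinP; apply: measurable_funX; exact: measurable_dot_inp.
  have abs0 : (\int[rho]_z `|(dot (inp z) (r i) ^+ 2)%:E| = 0)%E.
    by rewrite -[RHS]e0; apply: eq_integral => z _; rewrite /= ger0_norm// sqr_ge0.
  have := (ae_eq_integral_abs rho measurableT mf).1 abs0.
  apply: filterS => z /(_ I) /= [] /eqP; rewrite sqrf_eq0 => /eqP.
  by [].
have : {ae rho, forall z : T, forall i, dot (inp z) (r i) = 0}.
  by apply: filter_forall => i; exact: aei.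
apply: filterS => z hz.
apply/esym/eqP; rewrite -subr_eq0; apply/eqP/matrixP => i j.
by rewrite (ord1 j) -rE hz mxE.
Qed.

End Population.

Section Sample.
Context {K : realType} {p : nat}.
Local Notation V := 'cV[K]_p.
Local Notation T := (sample_space K p).
Variables (z : nat -> T) (w0 : V).

Definition sample_moment (n : nat) : 'M[K]_p :=
  n%:R^-1 *: \sum_(i < n) inp (z i) *m (inp (z i))^T.

Definition sample_gradient (n : nat) : V :=
  n%:R^-1 *: \sum_(i < n) residual w0 (z i) *: inp (z i).

Lemma sample_moment_sym n : (sample_moment n)^T = sample_moment n.
Proof.
rewrite linearZ/= linear_sum/=; congr (_ *: _); apply: eq_bigr => i _.
by rewrite trmx_mul trmxK.
Qed.

Lemma sample_moment_proj (Q : 'M[K]_p) n : (forall i, Q *m inp (z i) = inp (z i)) ->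
  Q *m sample_moment n = sample_moment n.
Proof.
move=> Qz; rewrite -scalemxAr mulmx_sumr; congr (_ *: _).
by apply: eq_bigr => i _; rewrite mulmxA Qz.
Qed.

Lemma sample_gradient_proj (Q : 'M[K]_p) n : (forall i, Q *m inp (z i) = inp (z i)) ->
  Q *m sample_gradient n = sample_gradient n.
Proof.
move=> Qz; rewrite -scalemxAr mulmx_sumr; congr (_ *: _).
by apply: eq_bigr => i _; rewrite -scalemxAr Qz.
Qed.

Lemma sample_momentE n i j :
  sample_moment n i j = n%:R^-1 * \sum_(k < n) inp (z k) i 0 * inp (z k) j 0.
Proof.
rewrite mxE summxE; congr (_ * _); apply: eq_bigr => k _.
by rewrite mxE big_ord1 mxE.
Qed.

Lemma sample_gradientE n i :
  sample_gradient n i 0 = n%:R^-1 * \sum_(k < n) residual w0 (z k) * inp (z k) i 0.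
Proof.
by rewrite mxE summxE; congr (_ * _); apply: eq_bigr => k _; rewrite mxE.
Qed.

Lemma dot_suml n (u : 'I_n -> V) v : dot (\sum_i u i) v = \sum_i dot (u i) v.
Proof.
elim/big_ind2 : _ => [|a b c d <- <-|//]; first exact: dot0l.
exact: dotDl.
Qed.

Lemma empirical_risk_expansion n w :
  (2 * n%:R)^-1 * \sum_(i < n) (dot (inp (z i)) w - out (z i)) ^+ 2 =
  quad (sample_moment n) (sample_gradient n) (w - w0) +
  (2 * n%:R)^-1 * \sum_(i < n) residual w0 (z i) ^+ 2.
Proof.
set h := w - w0.
have e1 : dot (sample_moment n *m h) h = n%:R^-1 * \sum_(i < n) dot (inp (z i)) h ^+ 2.
  rewrite -scalemxAl dotZl mulmx_suml dot_suml; congr (_ * _).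
  apply: eq_bigr => i _; set x := inp (z i).
  have -> : x *m x^T *m h = dot x h *: x.
    by rewrite -mulmxA [x^T *m h]mx11_scalar -dotE mul_mx_scalar.
  by rewrite dotZl expr2.
have e2 : dot (sample_gradient n) h =
    n%:R^-1 * \sum_(i < n) residual w0 (z i) * dot (inp (z i)) h.
  rewrite dotZl dot_suml; congr (_ * _).
  by apply: eq_bigr => i _; rewrite dotZl.
rewrite /quad e1 e2 invfM.
have -> : \sum_(i < n) (dot (inp (z i)) w - out (z i)) ^+ 2 =
    \sum_(i < n) dot (inp (z i)) h ^+ 2 +
    2 * \sum_(i < n) residual w0 (z i) * dot (inp (z i)) h +
    \sum_(i < n) residual w0 (z i) ^+ 2.
  rewrite mulr_sumr -!big_split/=; apply: eq_bigr => i _.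
  have -> : w = w0 + h by rewrite /h addrC subrK.
  by rewrite dotDr /residual; ring.
(* The identity is linear in the inverse of [n], whose default value at [n = 0] is thus covered. *)
by move: (n%:R^-1) => c; lra.
Qed.

Lemma argmin_empirical_shifted (R : V -> \bar K) (l : K) n w :
  argmin (empirical_objective R l n z) [set: V] w ->
  argmin (shifted_objective R w0 l (sample_moment n) (sample_gradient n)) [set: V] w.
Proof.
pose c : K := (2 * n%:R)^-1 * \sum_(i < n) residual w0 (z i) ^+ 2.
have objE v : empirical_objective R l n z v =
    (shifted_objective R w0 l (sample_moment n) (sample_gradient n) v + c%:E)%E.
  rewrite /empirical_objective /shifted_objective (empirical_risk_expansion n v).
  by rewrite EFinD addeA.
move=> [_ hw]; split=> // v _; have := hw v I.
by rewrite (objE w) (objE v) leeD2rE.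
Qed.

End Sample.

Section Normalized_limits.
Context {K : realType}.

Lemma mx_norm_scaled_cvg0 m n (B : nat -> 'M[K]_(m, n)) (l : nat -> K) :
  (forall k, 0 < l k) ->
  (forall i j, `|B k i j| / l k @[k --> \oo] --> (0 : K)) ->
  `|B k| / l k @[k --> \oo] --> (0 : K).
Proof.
move=> l0 hB; apply/cvgr0Pnorm_lt => e e0.
have e20 : 0 < e / 2 by rewrite divr_gt0.
have near_ij i j : \forall k \near \oo, `|B k i j| < e / 2 * l k.
  have /cvgr0Pnorm_lt /(_ _ e20) := hB i j; apply: filterS => k.
  by rewrite ger0_norm ?divr_ge0// 1?ltW// ltr_pdivrMr.
have : \forall k \near \oo, forall i j, `|B k i j| < e / 2 * l k.
  by apply: filter_forall => i; apply: filter_forall.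
apply: filterS => k hk; rewrite ger0_norm ?divr_ge0// 1?ltW// ltr_pdivrMr//.
apply: (@le_lt_trans _ _ (e / 2 * l k)).
  by apply: norm_le_coord => [|i j]; [rewrite mulr_ge0// ltW|rewrite ltW].
by rewrite ltr_pM2r//; lra.
Qed.

End Normalized_limits.

Section Almost_sure.
Context {d dT : measure_display} {Omega : measurableType d}
  {T : measurableType dT} {K : realType}.
Variables (P : probability Omega K) (rho : probability T K).

Lemma ae_all_samples (Z : nat -> {RV P >-> T}) (hZ : iid_from rho Z) (S : set T) :
  {ae rho, forall x, S x} -> {ae P, forall w, forall i, S (Z i w)}.
Proof.
move=> [N [mN N0 NS]]; apply: ae_foralln => i.
exists (Z i @^-1` N); split.
- by rewrite -[X in measurable X]setTI; exact: measurable_funP.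
- by rewrite -N0 -(hZ.2 i N mN).
- by move=> w /= nS; apply: NS.
Qed.

End Almost_sure.

Theorem theorem1 (K : realType) (p : nat)
    (R : 'cV[K]_p -> \bar K)
    (hproper : proper_function R) (hlsc : lower_semicontinuous R)
    (hconvex : econvex R) (hbelow : bounded_below R)
    (M Ms : set (set 'cV[K]_p)) (hmirror : mirror_stratifiable R M Ms)
    (rho : probability (sample_space K p) K)
    (w0 : 'cV[K]_p)
    (hw0 : argmin R (argmin (population_risk rho) [set: 'cV[K]_p]) = [set w0])
    (hx4 : ('E_rho[fun z => (enorm (inp z) ^+ 4)%R] < +oo)%E)
    (hy4 : ('E_rho[fun z => (`|out z| ^+ 4)%R] < +oo)%E)
    (Cdag : 'M[K]_p) (hCdag : is_moore_penrose (second_moment rho) Cdag)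
    (eta0 : 'cV[K]_p)
    (heta0 : argmin (dual_objective Cdag)
               (subdiff R w0 `&` matrix_image (second_moment rho)) eta0)
    (d : measure_display) (Omega : measurableType d) (P : probability Omega K)
    (Z : nat -> {RV P >-> sample_space K p}) (hZ : iid_from rho Z)
    (lambda : nat -> K) (hlambda_pos : forall n, 0 < lambda n)
    (hlambda0 : lambda n @[n --> \oo] --> (0 : K))
    (hlambda_rate :
       lambda n * Num.sqrt (n%:R / ln (ln n%:R)) @[n --> \oo] --> +oo) :
  {ae P, forall omega, \forall n \near \oo,
     forall what : 'cV[K]_p,
       argmin (empirical_objective R (lambda n) n (fun i => Z i omega))
         [set: 'cV[K]_p] what ->
       strat_le (stratum_of M w0) (stratum_of M what) /\
       strat_le (stratum_of M what)
         (J_op (conjugate R) (stratum_of Ms eta0))}.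
Proof.
have [w0_min w0_minR] : argmin R (argmin (population_risk rho) [set: 'cV[K]_p]) w0.
  by rewrite hw0.
have grad0 := gradient_eq0 hx4 hy4 w0_min.
set C := second_moment rho in hCdag heta0 *.
have sC : C^T = C := second_moment_sym hx4 hy4.
have C0 : forall w, 0 <= dot (C *m w) w := second_moment_psd hx4 hy4.
have uniq w : C *m (w - w0) = 0 -> (R w <= R w0)%E -> w = w0.
  (* The risk is constant along the kernel of [C], so [w] competes in the constrained problem that
     [w0] alone solves. *)
  move=> Cw Rw; have : argmin R (argmin (population_risk rho) [set: 'cV[K]_p]) w.
    split.
      split => // v _; have -> : w = w0 + (w - w0) by rewrite addrC subrK.
      by rewrite (population_risk_kernel hx4 hy4 w0_min Cw); apply: w0_min.2.
    by move=> v hv; apply: (le_trans Rw); exact: w0_minR.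
  by rewrite hw0.
have ae_image := ae_all_samples hZ (ae_inp_image hx4 hy4 hCdag).
have ae_moment : {ae P, forall omega, forall i j,
    `|(sample_moment (fun k => Z k omega) n - C) i j| / lambda n @[n --> \oo] --> (0 : K)}.
  apply: filter_forall => i; apply: filter_forall => j.
  have := empirical_mean_rate hZ hlambda_pos hlambda_rate (measurable_prod_coord i j)
    (dominated_sqr hx4 hy4 (measurable_prod_coord i j) (prod_coord_sqr_le i j))
    (integral_prod_coord hx4 hy4 i j).
  apply: filterS => omega; apply: cvg_trans; apply: near_eq_cvg; apply: nearW => n.
  by rewrite [in RHS]mxE sample_momentE [in RHS]mxE.
have ae_gradient : {ae P, forall omega, forall i,
    `|sample_gradient (fun k => Z k omega) w0 n i 0| / lambda n @[n --> \oo] --> (0 : K)}.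
  apply: filter_forall => i.
  have mean0 : (\int[rho]_z (residual w0 z * inp z i 0)%:E = 0%:E)%E.
    by rewrite (integral_residual_inp w0 hx4 hy4) grad0 mxE.
  have := empirical_mean_rate hZ hlambda_pos hlambda_rate (measurable_residual_inp w0 i)
    (dominated_sqr hx4 hy4 (measurable_residual_inp w0 i) (residual_inp_sqr_le w0 i))
    mean0.
  apply: filterS => omega; apply: cvg_trans; apply: near_eq_cvg; apply: nearW => n.
  by rewrite sample_gradientE subr0.
have sub0 : subdiff R w0 eta0 by have [[]] := heta0.
(* The strata fix the radii [tau] and [eps] once and for all, before any sample path is
   considered. *)
have [U /nbhs_normP[tau /= tau0 hU] [U' /nbhs_normP[eps /= eps0 hU'] local]] :=
  mirror_strat_local hproper hmirror sub0.
apply: filterS3 ae_image ae_moment ae_gradient => omega image moment grad.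
set z := fun k => Z k omega in image moment grad *.
have g_cvg : `|sample_gradient z w0 n| / lambda n @[n --> \oo] --> (0 : K).
  by apply: mx_norm_scaled_cvg0 => // i j; rewrite (ord1 j); exact: grad.
have A_rate : `|sample_moment z n - C| / lambda n @[n --> \oo] --> (0 : K).
  by apply: mx_norm_scaled_cvg0 => // i j; exact: moment.
(* Multiplying the rate by [lambda n], which tends to 0, gives the plain convergence that the
   deterministic part takes as input. *)
have A_cvg : `|sample_moment z n - C| @[n --> \oo] --> (0 : K).
  have /(_ _) := cvgM A_rate hlambda0; rewrite mulr0.
  apply: cvg_trans; apply: near_eq_cvg; apply: nearW => n.
  by rewrite /= divfK// gt_eqF.
have sA n := sample_moment_sym z n.
have QA n := sample_moment_proj n image.
have Qg n := sample_gradient_proj w0 n image.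
have near_w0 := argmin_near_w0 hproper hlsc hconvex sC C0 hCdag uniq heta0
  hlambda_pos sA QA Qg hlambda0 g_cvg A_cvg tau0.
have near_eta0 := etahat_near_eta0 hproper hlsc hconvex sC C0 hCdag uniq heta0
  hlambda_pos sA QA Qg hlambda0 g_cvg A_cvg eps0.
apply: filterS2 near_w0 near_eta0 => n close_w close_eta w /(argmin_empirical_shifted w0) hw.
apply: (local w (etahat w0 (lambda n) (sample_moment z n) (sample_gradient z w0 n) w)).
- by apply: hU; rewrite /= distrC; exact: close_w.
- by apply: hU'; rewrite /= distrC; exact: close_eta.
- exact: (etahat_subdiff hproper hconvex heta0 (hlambda_pos n) (sA n) hw).
Qed.
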